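(* Let $\mathcal M$ be a countable MDP, let $\{A_i\}_{i\in\mathbb N}$ be a sequence of sets of transitions of $\mathcal M$ that is monotone decreasing with respect to set inclusion, and consider the objective $\varphi=\bigcap_{i\in\mathbb N}\mathsf G\mathsf F A_i$. There exists a single randomized positional strategy that is optimal for $\varphi$ from every state that has an optimal strategy for $\varphi$.
   Context: An MDP $\mathcal M$ consists of a countable set $S$ of states partitioned into controlled states $S_C$ and random states $S_R$; a transition relation $\longrightarrow\subseteq S\times S$ such that every state has at least one successor (the set $\mathrm{Succ}(s)$ of successors of $s$ may be infinite); and a function $P$ assigning to each random state $s$ a probability distribution on $\mathrm{Succ}(s)$. A run is an infinite sequence $s_0e_0s_1e_1\cdots$ with $e_i=(s_i,s_{i+1})\in\longrightarrow$; a history is a finite prefix of a run ending in a controlled state. A (general) strategy $\sigma$ maps each history ending in $s$ to a probability distribution on $\mathrm{Succ}(s)$. A randomized positional strategy is one whose choices depend only on the current state, i.e. a function $\sigma$ on $S_C$ with $\sigma(s)$ a probability distribution on $\mathrm{Succ}(s)$. A strategy $\sigma$ and a start state $s$ induce a probability measure $\mathcal P_{\mathcal M,s,\sigma}$ on the Borel $\sigma$-algebra of runs from $s$. For an event $\varphi$, $\mathrm{val}(s)=\sup_\sigma\mathcal P_{\mathcal M,s,\sigma}(\varphi)$ over all strategies; $\sigma$ is optimal for $\varphi$ from $s$ if $\mathcal P_{\mathcal M,s,\sigma}(\varphi)=\mathrm{val}(s)$. $\mathsf G\mathsf F A$ is the set of runs that take transitions in $A$ infinitely often. *)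

(* Defs.v *)
From HB Require Import structures.
From mathcomp Require Import all_boot all_order all_algebra.
From mathcomp Require Import all_classical all_reals all_analysis.

Set Implicit Arguments.
Unset Strict Implicit.
Unset Printing Implicit Defensive.

Import Order.TTheory GRing.Theory Num.Theory.

Local Open Scope classical_set_scope.
Local Open Scope ring_scope.

(* Discrete probability distributions on D, as mass functions extended by 0
   to the whole of T. *)
Definition distribution_on (R : realType) (T : choiceType) (D : set T)
    (p : T -> R) : Prop :=
  [/\ forall t, 0 <= p t,
      forall t, ~ D t -> p t = 0 &
      (\esum_(t in D) (p t)%:E = 1)%E].

Record mdp (R : realType) := MDP {
  mdp_state :> countType;
  controlled : pred mdp_state;
  trans : rel mdp_state;
  trans_total : forall s, exists t, trans s t;
  (* unconstrained, and never used, at controlled states *)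
  prob : mdp_state -> mdp_state -> R;
  prob_distr : forall s, ~~ controlled s ->
    distribution_on [set t | trans s t] (prob s)
}.

Definition transitions (R : realType) (M : mdp R) : set (M * M) :=
  [set e | trans e.1 e.2].
Arguments transitions {R} M _.

(* Runs from s. The transitions of a run are determined by its states: the
   i-th one is the pair (rho i, rho i.+1). *)
Record run (R : realType) (M : mdp R) (s : M) := Run {
  run_state :> nat -> M;
  run_init : run_state 0%N = s;
  run_trans : forall i, trans (run_state i) (run_state i.+1)
}.

Definition run_edge (R : realType) (M : mdp R) (s : M) (rho : run s) (i : nat)
  : M * M := (rho i, rho i.+1).

(* The measurable types of the library have to be inhabited. *)
Definition default_run (R : realType) (M : mdp R) (s : M) : run s :=
  @Run R M s (fun i => iter i (fun t => xchoose (trans_total t)) s) erefl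
    (fun i => xchooseP (trans_total _)).

HB.instance Definition _ (R : realType) (M : mdp R) (s : M) :=
  gen_eqMixin (run s).
HB.instance Definition _ (R : realType) (M : mdp R) (s : M) :=
  gen_choiceMixin (run s).
HB.instance Definition _ (R : realType) (M : mdp R) (s : M) :=
  isPointed.Build (run s) (default_run s).

(* The runs from s that agree with rho on the states 0, ..., n. *)
Definition cylinder (R : realType) (M : mdp R) (s : M) (rho : run s) (n : nat)
  : set (run s) := [set rho' | forall i, (i <= n)%N -> rho' i = rho i].

Definition cylinders (R : realType) (M : mdp R) (s : M) : set (set (run s)) :=
  [set C | exists rho n, C = cylinder rho n].
Arguments cylinders {R M} s _.

(* The Borel sigma-algebra, generated by the cylinders. *)
Notation run_space s := (g_sigma_algebraType (cylinders s)).

(* The history s_0 ... s_n is split into h = [:: s_0; ...; s_(n-1)] and its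
   last state s = s_n. *)
Definition is_history (R : realType) (M : mdp R) (h : seq M) (s : M) : Prop :=
  controlled s /\
  exists (s0 : M) (rho : run s0) (n : nat), h = mkseq rho n /\ s = rho n.

Record strategy (R : realType) (M : mdp R) := Strategy {
  choice_at :> seq M -> M -> M -> R;
  choice_distr : forall h s, is_history h s ->
    distribution_on [set t | trans s t] (choice_at h s)
}.

Definition positional (R : realType) (M : mdp R) (sigma : strategy M) : Prop :=
  forall h h' s, is_history h s -> is_history h' s -> sigma h s = sigma h' s.

Definition step_prob (R : realType) (M : mdp R) (sigma : strategy M)
    (h : seq M) (s t : M) : R :=
  if controlled s then sigma h s t else prob s t.

(* mu is the probability measure on the runs from s induced by sigma. The
   prescribed values on cylinders determine it uniquely, and it exists by
   the Ionescu-Tulcea theorem. *)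
Definition run_law (R : realType) (M : mdp R) (sigma : strategy M) (s : M)
    (mu : probability (run_space s) R) : Prop :=
  forall (rho : run s) (n : nat),
    mu (cylinder rho n) =
    (\prod_(i < n) step_prob sigma (mkseq rho i) (rho i) (rho i.+1))%:E.

Definition value (R : realType) (M : mdp R) (s : M) (phi : set (run s))
  : \bar R :=
  ereal_sup [set x | exists (sigma : strategy M)
                            (mu : probability (run_space s) R),
                       run_law sigma mu /\ x = mu phi].

Definition optimal (R : realType) (M : mdp R) (s : M) (phi : set (run s))
    (sigma : strategy M) : Prop :=
  exists mu : probability (run_space s) R,
    run_law sigma mu /\ mu phi = value phi.

(* The runs from s that take transitions in A infinitely often. *)
Definition GF (R : realType) (M : mdp R) (A : set (M * M)) (s : M)
  : set (run s) :=
  [set rho | forall n, exists i, (n <= i)%N /\ A (run_edge rho i)].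
Arguments GF {R M} A s _.

(* Main.v *)
Require Import Defs.
From HB Require Import structures.
From mathcomp Require Import all_boot all_order all_algebra.
From mathcomp Require Import all_classical all_reals all_analysis.
From mathcomp Require Import ring lra.

(* Write win(x, s) for the probability of the objective under the strategy x
   from s, best(s) for its supremum over x, and w for the function that equals
   best at the states with an optimal strategy and 0 elsewhere.

   An optimal strategy only makes moves that preserve w on average and lead to
   states at which its continuation is optimal.  Hence, in the game where only
   moves with E w >= w(s) are allowed and where w(t) is paid when the first
   A_i-edge (s, t) is taken, the value is w, for every i.

   Moves can be fixed at finitely many states without destroying this, as long
   as a positive fraction of the mass stays free there: before returning to
   these states one plays as before, and at them one succeeds, with a uniformly
   positive probability, in following an unconstrained strategy.  A stationary
   choice nearly optimal from s for A_i earns nearly w(s) within finitely many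
   steps, and so does its restriction to finitely many states, diluted by a
   small free fraction.  Enumerating all triples (s, A_i, error) and fixing such
   a diluted choice for each of them in turn yields a stationary strategy that
   earns the full w(s) from every s, for every i.  Since w does not decrease on
   average along it, the same holds after every time n, so that it wins with
   probability at least w(s). *)

Local Open Scope classical_set_scope.
Local Open Scope ring_scope.

Set Implicit Arguments.
Unset Strict Implicit.
Unset Printing Implicit Defensive.

Import Order.TTheory GRing.Theory Num.Theory.
Import numFieldNormedType.Exports.

(** * Expectations over countable sets *)

Section CountableSums.
Variables (R : realType) (T : countType).
Implicit Types (b f g : T -> R).

(** Sums over T become series over codes, where a number that codes no element contributes 0. *)
Definition at_code f (k : nat) : R := oapp f 0 (@pickle_inv T k).

Definition tsum f : R := limn (series (at_code f)).

Definition psum f n : R := \sum_(0 <= k < n) at_code f k.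

Lemma at_code_pickle f t : at_code f (pickle t) = f t.
Proof. by rewrite /at_code pickleK_inv. Qed.

Lemma at_code_ge0 f k : (forall t, 0 <= f t) -> 0 <= at_code f k.
Proof. by move=> f0; rewrite /at_code; case: pickle_inv => /=. Qed.

Lemma psum_le f g n : (forall t, f t <= g t) -> psum f n <= psum g n.
Proof.
by move=> fg; apply: ler_sum => k _; rewrite /at_code; case: pickle_inv => /=.
Qed.

Lemma psum_ge0 f n : (forall t, 0 <= f t) -> 0 <= psum f n.
Proof. by move=> f0; apply: sumr_ge0 => k _; exact: at_code_ge0. Qed.

Lemma psum_nd f : (forall t, 0 <= f t) -> {homo psum f : n m / (n <= m)%N >-> n <= m}.
Proof.
move=> f0 n m nm; rewrite /psum (big_cat_nat _ nm)//= lerDl.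
by apply: sumr_ge0 => k _; exact: at_code_ge0.
Qed.

Lemma at_codeZ c f : at_code (fun t => c * f t) = c *: at_code f.
Proof.
by apply/funext => k; rewrite /at_code /= fctE; case: pickle_inv => //=; rewrite scaler0.
Qed.

Lemma at_codeD f g : at_code (fun t => f t + g t) = at_code f + at_code g.
Proof.
by apply/funext => k; rewrite /at_code !fctE; case: pickle_inv => //=; rewrite addr0.
Qed.

Lemma psumZ c f n : psum (fun t => c * f t) n = c * psum f n.
Proof. by rewrite /psum at_codeZ mulr_sumr. Qed.

(** Mass below 1 is allowed, because parts of moves and truncated kernels are integrated as well. *)
Definition subdist b := (forall t, 0 <= b t) /\ (forall n, psum b n <= 1).

Definition bounded_fn g := exists C, forall t, `|g t| <= C.

Lemma bounded_itv g : (forall t, 0 <= g t <= 1) -> bounded_fn g.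
Proof. by move=> g01; exists 1 => t; rewrite ger0_norm; case/andP: (g01 t). Qed.

Lemma bounded_fnD f g : bounded_fn f -> bounded_fn g ->
  bounded_fn (fun t => f t + g t).
Proof.
move=> [C fC] [D gD]; exists (C + D) => t.
by apply: le_trans (ler_normD _ _) _; apply: lerD.
Qed.

Lemma bounded_fnZ c g : bounded_fn g -> bounded_fn (fun t => c * g t).
Proof.
by move=> [C fC]; exists (`|c| * C) => t; rewrite normrM ler_wpM2l.
Qed.

Lemma bounded_fn_cst (c : R) : bounded_fn (fun=> c).
Proof. by exists `|c|. Qed.

Lemma bounded_fnB f g : bounded_fn f -> bounded_fn g ->
  bounded_fn (fun t => f t - g t).
Proof.
move=> bf /(bounded_fnZ (-1)) bg; have [C hC] := bounded_fnD bf bg.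
by exists C => t; move: (hC t); rewrite mulN1r.
Qed.

Definition Ex b g := tsum (fun t => b t * g t).

Lemma nonneg_cvg f (C : R) : (forall t, 0 <= f t) -> (forall n, psum f n <= C) ->
  cvgn (series (at_code f)).
Proof.
move=> f0 fC; apply: nondecreasing_is_cvgn; first exact: (psum_nd f0).
by exists C => _ [n _ <-]; apply: fC.
Qed.

Lemma Ex_cvg b g : subdist b -> bounded_fn g ->
  cvgn (series (at_code (fun t => b t * g t))).
Proof.
move=> [b0 b1] [C gC]; apply: normed_cvg => /=.
have -> : [normed series (at_code (fun t => b t * g t))] =
   series (at_code (fun t => `|b t * g t|)).
  apply/funext => n; rewrite /series /=; apply: eq_bigr => k _.
  by rewrite /at_code; case: pickle_inv => //=; rewrite normr0.
apply: (@nonneg_cvg _ `|C|) => // n.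
apply: (@le_trans _ _ (psum (fun t => `|C| * b t) n)).
  apply: psum_le => t; rewrite normrM (ger0_norm (b0 t)) mulrC ler_wpM2r//.
  exact: le_trans (gC t) (ler_norm _).
by rewrite psumZ ler_piMr.
Qed.

Lemma eq_Ex b f g : (forall t, b t != 0 -> f t = g t) -> Ex b f = Ex b g.
Proof.
move=> fg; rewrite /Ex; congr tsum; apply/funext => t.
by have [->|/fg ->//] := eqVneq (b t) 0; rewrite !mul0r.
Qed.

Lemma ExD b f g : subdist b -> bounded_fn f -> bounded_fn g ->
  Ex b (fun t => f t + g t) = Ex b f + Ex b g.
Proof.
move=> sb bf bg; rewrite /Ex /tsum -lim_seriesD; [|exact: Ex_cvg..].
by rewrite -at_codeD; under eq_fun do rewrite mulrDr.
Qed.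

Lemma ExZ b c g : subdist b -> bounded_fn g ->
  Ex b (fun t => c * g t) = c * Ex b g.
Proof.
move=> sb bg; rewrite /Ex /tsum -[RHS]lim_seriesZ; last exact: Ex_cvg.
by rewrite -at_codeZ; under eq_fun do rewrite mulrCA.
Qed.

Lemma ExB b f g : subdist b -> bounded_fn f -> bounded_fn g ->
  Ex b (fun t => f t - g t) = Ex b f - Ex b g.
Proof.
move=> sb bf bg; rewrite -mulN1r -ExZ// -ExD//; last exact: bounded_fnZ.
by under [in RHS]eq_Ex do rewrite mulN1r.
Qed.

Lemma Ex_le b f g : subdist b -> bounded_fn f -> bounded_fn g ->
  (forall t, 0 < b t -> f t <= g t) -> Ex b f <= Ex b g.
Proof.
move=> sb bf bg fg; apply: ler_lim; [exact: Ex_cvg..|].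
apply: nearW => n; apply: psum_le => t; case: sb => b0 _.
have := b0 t; rewrite le_eqVlt => /orP[/eqP<-|bt]; first by rewrite !mul0r.
by rewrite ler_pM2l// fg.
Qed.

Lemma ExDl b c g : subdist b -> subdist c -> bounded_fn g ->
  Ex (fun t => b t + c t) g = Ex b g + Ex c g.
Proof.
move=> sb sc bg; rewrite /Ex /tsum -lim_seriesD; [|exact: Ex_cvg..].
by rewrite -at_codeD; under eq_fun do rewrite mulrDl.
Qed.

Lemma ExZl b c g : subdist b -> bounded_fn g ->
  Ex (fun t => c * b t) g = c * Ex b g.
Proof.
move=> sb bg; rewrite /Ex /tsum -[RHS]lim_seriesZ; last exact: Ex_cvg.
by rewrite -at_codeZ; under eq_fun do rewrite -mulrA.
Qed.

Lemma psum_le_tsum f n : (forall t, 0 <= f t) -> cvgn (series (at_code f)) ->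
  psum f n <= tsum f.
Proof. by move=> f0 cf; apply: nondecreasing_cvgn_le => //; exact: psum_nd. Qed.

Lemma term_le_tsum f t : (forall t, 0 <= f t) -> cvgn (series (at_code f)) ->
  f t <= tsum f.
Proof.
move=> f0 cf; apply: le_trans (psum_le_tsum (pickle t).+1 f0 cf).
by rewrite /psum big_nat_recr//= at_code_pickle lerDr; apply: psum_ge0.
Qed.

Lemma tsum_le f (C : R) : cvgn (series (at_code f)) ->
  (forall n, psum f n <= C) -> tsum f <= C.
Proof. by move=> cf fC; apply: limr_le => //; apply: nearW. Qed.

Lemma Ex1 b : Ex b (fun=> 1) = tsum b.
Proof. by rewrite /Ex; under eq_fun do rewrite mulr1. Qed.

Lemma subdist_cvg b : subdist b -> cvgn (series (at_code b)).
Proof. by case=> b0 b1; apply: (nonneg_cvg b0 b1). Qed.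

Lemma subdist_tsum b : subdist b -> 0 <= tsum b <= 1.
Proof.
move=> sb; rewrite (tsum_le (subdist_cvg sb)) ?andbT; last by case: sb.
have := psum_le_tsum 0 sb.1 (subdist_cvg sb).
by rewrite /psum big_nil.
Qed.

Lemma Ex_cst b c : subdist b -> Ex b (fun=> c) = c * tsum b.
Proof.
move=> sb; rewrite -Ex1 -ExZ//; last exact: bounded_fn_cst.
by under [in RHS]eq_Ex do rewrite mulr1.
Qed.

Lemma Ex_ge0 b g : subdist b -> bounded_fn g -> (forall t, 0 <= g t) -> 0 <= Ex b g.
Proof.
move=> sb bg g0; rewrite -(mul0r (tsum b)) -Ex_cst//.
by apply: Ex_le => //; exact: bounded_fn_cst.
Qed.

Lemma Ex_itv b g : subdist b -> (forall t, 0 <= g t <= 1) -> 0 <= Ex b g <= 1.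
Proof.
move=> sb g01; have bg := bounded_itv g01.
apply/andP; split; first by apply: Ex_ge0 => // t; case/andP: (g01 t).
apply: (@le_trans _ _ (Ex b (fun=> 1))).
  by apply: Ex_le => // [|t _]; [exact: bounded_fn_cst|case/andP: (g01 t)].
by rewrite Ex1; case/andP: (subdist_tsum sb).
Qed.

Lemma Ex_lel b c g : subdist b -> subdist c -> bounded_fn g ->
  (forall t, 0 <= g t) -> (forall t, b t <= c t) -> Ex b g <= Ex c g.
Proof.
move=> sb sc bg g0 bc; apply: ler_lim; [exact: Ex_cvg..|].
by apply: nearW => n; apply: psum_le => t; rewrite ler_wpM2r.
Qed.

Lemma cvg_psum (f_ : nat -> T -> R) f n : (forall t, f_ ^~ t @ \oo --> f t) ->
  (fun m => psum (f_ m) n) @ \oo --> psum f n.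
Proof.
move=> ff; elim: n => [|n IHn].
  by rewrite /psum big_nil; under eq_fun do rewrite big_nil; exact: cvg_cst.
rewrite /psum big_nat_recr//=; under eq_fun do rewrite big_nat_recr//=.
apply: cvgD => //; rewrite /at_code; case: pickle_inv => [t|] /=; first exact: ff.
exact: cvg_cst.
Qed.

Lemma psum_fatou (f_ : nat -> T -> R) f (C : R) n :
  (forall t, f_ ^~ t @ \oo --> f t) ->
  (forall m, psum (f_ m) n <= C) -> psum f n <= C.
Proof.
move=> ff fC; have cf := cvg_psum (n := n) ff; rewrite -(cvg_lim _ cf)//.
by apply: limr_le; [apply/cvg_ex; eexists; exact: cf|apply: nearW].
Qed.

(** Kernel and integrand may both vary: the bound passes to the limit in each finite partial sum,
    and from there to the series. *)
Lemma Ex_fatou (b_ g_ : nat -> T -> R) b g (C : R) :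
  (forall m, subdist (b_ m)) -> subdist b ->
  (forall m t, 0 <= g_ m t <= 1) -> (forall t, 0 <= g t <= 1) ->
  (forall t, b_ ^~ t @ \oo --> b t) -> (forall t, g_ ^~ t @ \oo --> g t) ->
  (forall m, Ex (b_ m) (g_ m) <= C) -> Ex b g <= C.
Proof.
move=> sb_ sb g_01 g01 bb gg hC; apply: tsum_le.
  by apply: Ex_cvg => //; exact: bounded_itv.
move=> n; apply: (@psum_fatou (fun m t => b_ m t * g_ m t)).
  by move=> t; apply: cvgM.
move=> m; apply: le_trans (hC m); apply: psum_le_tsum.
  by move=> t; rewrite mulr_ge0 ?(sb_ m).1//; case/andP: (g_01 m t).
by apply: Ex_cvg => //; exact: bounded_itv.
Qed.

End CountableSums.

(** * Suprema and infima of sequences, and monotone convergence *)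

Section SupInf.
Variable R : realType.
Implicit Types (u : nat -> R).

Definition supn (u : nat -> R) := sup (range u).
Definition infn (u : nat -> R) := inf (range u).

Lemma supn_ub u n : (forall n, 0 <= u n <= 1) -> u n <= supn u.
Proof.
move=> u01; apply: ub_le_sup; last by exists n.
by exists 1 => _ [m _ <-]; case/andP: (u01 m).
Qed.

Lemma supn_le u C : (forall n, u n <= C) -> supn u <= C.
Proof.
by move=> uC; apply: ge_sup; [exists (u 0%N), 0%N|move=> _ [m _ <-]].
Qed.

Lemma supn_itv u : (forall n, 0 <= u n <= 1) -> 0 <= supn u <= 1.
Proof.
move=> u01; rewrite (le_trans _ (supn_ub 0 u01)) ?supn_le//.
  by move=> n; case/andP: (u01 n).
by case/andP: (u01 0%N).
Qed.

Lemma supn_cvg u : (forall n, 0 <= u n <= 1) -> (forall n, u n <= u n.+1) ->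
  u @ \oo --> supn u.
Proof.
move=> u01 und; apply: nondecreasing_cvgn; first exact/nondecreasing_seqP.
by exists 1 => _ [m _ <-]; case/andP: (u01 m).
Qed.

Lemma infn_lb u n : (forall n, 0 <= u n <= 1) -> infn u <= u n.
Proof.
move=> u01; apply: ge_inf; last by exists n.
by exists 0 => _ [m _ <-]; case/andP: (u01 m).
Qed.

Lemma infn_ge u C : (forall n, C <= u n) -> C <= infn u.
Proof.
by move=> uC; apply: lb_le_inf; [exists (u 0%N), 0%N|move=> _ [m _ <-]].
Qed.

Lemma infn_itv u : (forall n, 0 <= u n <= 1) -> 0 <= infn u <= 1.
Proof.
move=> u01; rewrite infn_ge => [|n]; last by case/andP: (u01 n).
by rewrite (le_trans (infn_lb 0 u01))//; case/andP: (u01 0%N).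
Qed.

Lemma infn_cvg u : (forall n, 0 <= u n <= 1) -> (forall n, u n.+1 <= u n) ->
  u @ \oo --> infn u.
Proof.
move=> u01 und; apply: nonincreasing_cvgn; first exact/nonincreasing_seqP.
by exists 0 => _ [m _ <-]; case/andP: (u01 m).
Qed.

Variable T : countType.

Lemma Ex_supn (b : T -> R) (g : nat -> T -> R) : subdist b ->
  (forall m t, 0 <= g m t <= 1) -> (forall m t, g m t <= g m.+1 t) ->
  Ex b (fun t => supn (g ^~ t)) = supn (fun m => Ex b (g m)).
Proof.
move=> sb g01 gnd; apply/eqP; rewrite eq_le; apply/andP; split.
  apply: (@Ex_fatou _ _ (fun=> b) g) => //.
  - by move=> t; apply: supn_itv.
  - by move=> t; exact: cvg_cst.
  - by move=> t; apply: supn_cvg.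
  - by move=> m; apply: (@supn_ub (fun m => Ex b (g m))) => n; exact: Ex_itv.
apply: supn_le => m; apply: Ex_le => //; [exact: bounded_itv| |].
  by apply: bounded_itv => t; exact: supn_itv.
by move=> t _; apply: (@supn_ub (g ^~ t)).
Qed.

Lemma Ex_infn (b : T -> R) (g : nat -> T -> R) : subdist b ->
  (forall m t, 0 <= g m t <= 1) -> (forall m t, g m.+1 t <= g m t) ->
  Ex b (fun t => infn (g ^~ t)) = infn (fun m => Ex b (g m)).
Proof.
move=> sb g01 gni.
have i01 t : 0 <= infn (g ^~ t) <= 1 by apply: infn_itv.
apply/eqP; rewrite eq_le; apply/andP; split.
  apply: infn_ge => m; apply: Ex_le => //; [exact: bounded_itv..|].
  by move=> t _; apply: (@infn_lb (g ^~ t)).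
have c1 := @bounded_fn_cst R T 1.
have bi := bounded_itv i01; have bg m := bounded_itv (g01 m).
rewrite -lerN2 -(lerD2l (Ex b (fun=> 1))) -ExB//.
(* Fatou is applied to 1 - g, which turns the decreasing sequence into an increasing one. *)
apply: (@Ex_fatou _ _ (fun=> b) (fun m t => 1 - g m t)) => //.
- by move=> m t; have := g01 m t; lra.
- by move=> t; have := i01 t; lra.
- by move=> t; exact: cvg_cst.
- by move=> t; apply: cvgB; [exact: cvg_cst|exact: infn_cvg].
move=> m; rewrite ExB// lerD2l lerN2.
by apply: (@infn_lb (fun m => Ex b (g m))) => n; exact: Ex_itv.
Qed.

End SupInf.

(** * Reachability payoffs *)

Lemma le_eps (R : realType) (x y : R) : (forall e, 0 < e -> x - e <= y) -> x <= y.
Proof. by move=> h; apply/ler_addgt0Pr => e /h; rewrite lerBlDr. Qed.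

Lemma bernoulli_le (R : realType) (x : R) n : 0 <= x <= 1 -> 1 - n%:R * x <= (1 - x) ^+ n.
Proof.
move=> /andP[x0 x1]; elim: n => [|n IHn]; first by rewrite mul0r subr0 expr0.
rewrite exprS; apply: (@le_trans _ _ ((1 - x) * (1 - n%:R * x))); last first.
  by apply: ler_wpM2l => //; lra.
have n0 : 0 <= n%:R * x * x :> R by rewrite !mulr_ge0.
by rewrite -natr1; lra.
Qed.

Lemma expr_small (R : realType) (x e : R) : 0 <= x < 1 -> 0 < e -> exists n, x ^+ n <= e.
Proof.
move=> /andP[x0 x1] e0.
have /cvgrPdist_lt /(_ _ e0) [n _ hn] : x ^+ n @[n --> \oo] --> (0 : R).
  by apply: cvg_expr; rewrite ger0_norm.
exists n; move: (hn n (leqnn n)) => /=; rewrite sub0r normrN ger0_norm ?exprn_ge0//.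
exact: ltW.
Qed.

Section Bellman.
Variables (R : realType) (T : countType) (w : T -> R) (w01 : forall t, 0 <= w t <= 1).
Implicit Types (A : set (T * T)) (g : T -> R) (D : T -> set (T -> R)).

(* The guard at states of weight 0, where moves may increase w on average, keeps
   the values of the game below w. *)
Definition pay A g s t : R :=
  if w s == 0 then 0 else if `[< A (s, t) >] then w t else g t.

Lemma pay01 A g s : (forall t, 0 <= g t <= 1) -> forall t, 0 <= pay A g s t <= 1.
Proof.
by move=> g01 t; rewrite /pay; case: ifP => _; [rewrite lexx ler01|case: ifP].
Qed.

Lemma bounded_pay A g s : (forall t, 0 <= g t <= 1) -> bounded_fn (pay A g s).
Proof. by move=> g01; exact/bounded_itv/pay01. Qed.

Lemma pay_le A f g s t : f t <= g t -> pay A f s t <= pay A g s t.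
Proof. by rewrite /pay; case: ifP => // _; case: ifP. Qed.

Definition bellman A D g s : R :=
  sup [set y | exists2 d, D s d & y = Ex d (pay A g s)].

Fixpoint bellman_iter (l : R) A D n : T -> R :=
  if n is n'.+1 then fun s => l * bellman A D (bellman_iter l A D n') s
  else fun=> 0.

(** The kernel c may lose mass, and lost mass is paid nothing; hence a smaller kernel never earns
    more. *)
Fixpoint reach_pay A (c : T -> T -> R) n : T -> R :=
  if n is n'.+1 then fun s => Ex (c s) (pay A (reach_pay A c n') s) else fun=> 0.

Lemma reach_pay01 A c n : (forall s, subdist (c s)) ->
  forall s, 0 <= reach_pay A c n s <= 1.
Proof.
by move=> sc; elim: n => [|n IHn] s /=; [rewrite lexx ler01|apply/Ex_itv/pay01].
Qed.

Lemma reach_pay_le A (c c' : T -> T -> R) n : (forall s, subdist (c s)) ->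
  (forall s, subdist (c' s)) -> (forall s t, c s t <= c' s t) ->
  forall s, reach_pay A c n s <= reach_pay A c' n s.
Proof.
move=> sc sc' cc'; elim: n => //= n IHn s.
have r01 := reach_pay01 A n sc; have r01' := reach_pay01 A n sc'.
apply: (@le_trans _ _ (Ex (c s) (pay A (reach_pay A c' n) s))).
  by apply: Ex_le => // [||t _]; [exact: bounded_pay..|exact: pay_le].
apply: Ex_lel => //; first exact: bounded_pay.
by move=> t; case/andP: (pay01 A s r01' t).
Qed.

(** * Value iteration over a family of allowed moves *)

Section Operator.
Variable D : T -> set (T -> R).
Hypothesis D_subdist : forall s d, D s d -> subdist d.
Hypothesis D_neq0 : forall s, exists d, D s d.

Lemma bellman_ub A g s d : (forall t, 0 <= g t <= 1) -> D s d ->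
  Ex d (pay A g s) <= bellman A D g s.
Proof.
move=> g01 sd; apply: ub_le_sup; last by exists d.
exists 1 => _ [d' sd' ->].
by case/andP: (Ex_itv (D_subdist sd') (pay01 A s g01)).
Qed.

Lemma bellman_le A g s C : (forall d, D s d -> Ex d (pay A g s) <= C) ->
  bellman A D g s <= C.
Proof.
move=> hC; apply: ge_sup; last by move=> _ [d sd ->]; exact: hC.
by have [d sd] := D_neq0 s; exists (Ex d (pay A g s)); exists d.
Qed.

Lemma bellman01 A g s : (forall t, 0 <= g t <= 1) -> 0 <= bellman A D g s <= 1.
Proof.
move=> g01; apply/andP; split; last first.
  by apply: bellman_le => d /D_subdist sd; case/andP: (Ex_itv sd (pay01 A s g01)).
have [d sd] := D_neq0 s; apply: le_trans (bellman_ub A g01 sd).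
by case/andP: (Ex_itv (D_subdist sd) (pay01 A s g01)).
Qed.

Lemma bellman_adherent A g s e : (forall t, 0 <= g t <= 1) -> 0 < e ->
  exists2 d, D s d & bellman A D g s - e <= Ex d (pay A g s).
Proof.
move=> g01 e0.
have hs : has_sup [set y | exists2 d, D s d & y = Ex d (pay A g s)].
  split; first by have [d sd] := D_neq0 s; exists (Ex d (pay A g s)); exists d.
  exists 1 => _ [d' sd' ->].
  by case/andP: (Ex_itv (D_subdist sd') (pay01 A s g01)).
have [_ [d sd ->] /ltW hd] := sup_adherent e0 hs.
by exists d.
Qed.

Lemma bellman_mono A f g s : (forall t, 0 <= f t <= 1) -> (forall t, 0 <= g t <= 1) ->
  (forall t, f t <= g t) -> bellman A D f s <= bellman A D g s.
Proof.
move=> f01 g01 fg; apply: bellman_le => d sd; apply: le_trans (bellman_ub A g01 sd).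
by apply: Ex_le => [|||t _]; [exact: D_subdist sd|exact: bounded_pay..|exact: pay_le].
Qed.

Lemma bellman_iter01 l A n s : 0 <= l <= 1 -> 0 <= bellman_iter l A D n s <= 1.
Proof.
move=> l01; elim: n s => [|n IHn] s /=; first by rewrite lexx ler01.
have := bellman01 A s IHn; move: (bellman _ _ _ _) => x /andP[x0 x1].
case/andP: l01 => l0 l1; apply/andP; split; first exact: mulr_ge0.
exact: mulr_ile1.
Qed.

Lemma bellman_iter_nd l A n s : 0 <= l <= 1 ->
  bellman_iter l A D n s <= bellman_iter l A D n.+1 s.
Proof.
move=> l01; elim: n s => [|n IHn] s; first by case/andP: (bellman_iter01 A 1 s l01).
have [l0 l1] := andP l01; apply: ler_wpM2l => //.
by apply: bellman_mono => // t; [exact: (bellman_iter01 A n)|exact: (bellman_iter01 A n.+1)].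
Qed.

Lemma bellman_iter_mono l A n m s : 0 <= l <= 1 -> (n <= m)%N ->
  bellman_iter l A D n s <= bellman_iter l A D m s.
Proof.
move=> l01; move: n m.
by apply/nondecreasing_seqP => n; exact: bellman_iter_nd.
Qed.

(** A payment within n steps is discounted at most n times. *)
Lemma bellman_iter_discount l A n s : 0 <= l <= 1 ->
  l ^+ n * bellman_iter 1 A D n s <= bellman_iter l A D n s.
Proof.
move=> l01; have [l0 l1] := andP l01.
have l11 : 0 <= (1 : R) <= 1 by rewrite ler01 lexx.
elim: n s => [|n IHn] s /=; first by rewrite mulr0.
rewrite exprS mul1r -mulrA; apply: ler_wpM2l => //.
have i1 t := bellman_iter01 A n t l11.
have ln : 0 <= l ^+ n <= 1 by rewrite exprn_ge0// exprn_ile1.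
apply/le_eps => e e0.
have [d sd hd] := bellman_adherent A s i1 e0.
apply: (@le_trans _ _ (l ^+ n * Ex d (pay A (bellman_iter 1 A D n) s))).
  have := ler_wpM2l (andP ln).1 hd; have := andP ln; nra.
rewrite -ExZ; [|exact: D_subdist sd|exact: bounded_pay].
have il t := bellman_iter01 A n t l01.
apply: le_trans (bellman_ub A il sd); apply: Ex_le.
- exact: D_subdist sd.
- exact/bounded_fnZ/bounded_pay.
- exact: bounded_pay.
move=> t _; rewrite /pay; case: ifP => _; first by rewrite mulr0.
by case: ifP => // _; rewrite ler_piMl//; [case/andP: (w01 t)|case/andP: ln].
Qed.

Definition bellman_lim l A s := supn (fun n => bellman_iter l A D n s).

Lemma bellman_lim01 l A s : 0 <= l <= 1 -> 0 <= bellman_lim l A s <= 1.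
Proof. by move=> l01; apply: supn_itv => n; exact: bellman_iter01. Qed.

Lemma bellman_iter_le_lim l A n s : 0 <= l <= 1 ->
  bellman_iter l A D n s <= bellman_lim l A s.
Proof.
move=> l01; apply: (@supn_ub _ (fun n => bellman_iter l A D n s)) => m.
exact: bellman_iter01.
Qed.

Lemma pay_supn A s t (g : nat -> T -> R) : (forall m t, 0 <= g m t <= 1) ->
  (forall m t, g m t <= g m.+1 t) ->
  (fun m => pay A (g m) s t) @ \oo --> pay A (fun t => supn (g ^~ t)) s t.
Proof.
move=> g01 gnd; rewrite /pay; case: ifP => _; first exact: cvg_cst.
by case: ifP => _; [exact: cvg_cst|exact: supn_cvg].
Qed.

(** A move that continues with horizon m earns at most the value with horizon m + 1; Fatou lets m
    tend to infinity. *)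
Lemma bellman_lim_excessive A s d : D s d ->
  Ex d (pay A (bellman_lim 1 A) s) <= bellman_lim 1 A s.
Proof.
move=> sd; have l11 : 0 <= (1 : R) <= 1 by rewrite ler01 lexx.
have i01 n t := bellman_iter01 A n t l11.
have ld := D_subdist sd.
have p01 m := pay01 A s (i01 m).
apply: (@Ex_fatou _ _ (fun=> d) (fun m => pay A (bellman_iter 1 A D m) s)) => //.
- exact/pay01/(fun t => bellman_lim01 A t l11).
- by move=> t; exact: cvg_cst.
- by move=> t; apply: pay_supn => // m u; exact: bellman_iter_nd.
move=> m; apply: le_trans (bellman_iter_le_lim A m.+1 s l11) => /=.
by rewrite mul1r; exact: bellman_ub.
Qed.

(* A stationary choice that is nearly greedy for the discounted problem nearly
   attains its value, because the discount makes the errors summable. *)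
Lemma stationary_near_optimal A n0 s0 e : 0 < e ->
  exists d, (forall s, D s (d s)) /\
    exists n, bellman_iter 1 A D n0 s0 - e <= reach_pay A d n s0.
Proof.
move=> e0.
(* Small enough that discounting by 1 - x over n0 steps costs at most e / 3, and at most 1/2 so that
   the discount factor stays positive. *)
pose x : R := Num.min (2^-1) (e / 3 / (n0.+1)%:R).
have n0p : (0 : R) < n0.+1%:R by rewrite ltr0n.
have x0 : 0 < x by rewrite lt_min invr_gt0 ltr0n !divr_gt0.
have x1 : x <= 2^-1 by rewrite ge_min lexx.
have xe : n0%:R * x <= e / 3.
  apply: (@le_trans _ _ (n0.+1%:R * x)); first by rewrite ler_wpM2r ?ler_nat// ltW.
  by rewrite mulrC -ler_pdivlMr// ge_min lexx orbT.
pose l := 1 - x.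
have l01 : 0 <= l <= 1 by rewrite /l; lra.
have l1 : 0 <= l < 1 by rewrite /l; lra.
have le3 : 1 - e / 3 <= l ^+ n0.
  by apply: le_trans (bernoulli_le n0 _); [lra|lra].
(* The loss allowed per step; its discounted sum is at most eta / x = e / 3. *)
pose eta := x * (e / 3).
have eta0 : 0 < eta by rewrite mulr_gt0// divr_gt0.
pose u := bellman_lim l A.
have u01 t : 0 <= u t <= 1 := bellman_lim01 A t l01.
have greedy s : exists d, D s d /\ u s - eta <= l * Ex d (pay A u s).
  have [d sd hd] := bellman_adherent A s u01 eta0.
  exists d; split => //.
  have ub : u s <= l * bellman A D u s.
    apply: supn_le => -[|n] /=.
      by have := bellman01 A s u01; case/andP: l01 => ? _ /andP[? _]; exact: mulr_ge0.
    rewrite ler_wpM2l ?(andP l01).1//; apply: bellman_mono => // t.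
      exact: bellman_iter01.
    exact: bellman_iter_le_lim.
  have := ler_wpM2l (andP l01).1 hd; rewrite mulrBr.
  have : l * eta <= eta by rewrite ler_piMl ?(andP l01).2// ltW.
  lra.
have [d hd] := choice greedy.
have sd s : subdist (d s) by apply: (@D_subdist s); exact: (hd s).1.
exists d; split; first by move=> s; exact: (hd s).1.
have [n hn] := expr_small l1 (divr_gt0 e0 (ltr0n R 3)).
exists n.
(* Here l ^ k bounds what is still to be earned after k steps, and e / 3 the accumulated greedy
   losses; the latter bound reproduces itself, since l * (e / 3) + eta = e / 3. *)
have key k s : u s - (l ^+ k + e / 3) <= reach_pay A d k s.
  elim: k s => [|k IHk] s; first by rewrite expr0 /=; have := u01 s; lra.
  have r01 := reach_pay01 A k sd.
  have r01' := reach_pay01 A k.+1 sd s.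
  have lk : 0 <= l ^+ k by rewrite exprn_ge0// (andP l01).1.
  have a0 : 0 <= l ^+ k + e / 3 by apply: addr_ge0 => //; lra.
  have h1 : Ex (d s) (pay A u s) - (l ^+ k + e / 3) <= reach_pay A d k.+1 s.
    apply: (@le_trans _ _ (Ex (d s) (fun t => pay A u s t - (l ^+ k + e / 3)))).
      rewrite ExB//; [|exact: bounded_pay|exact: bounded_fn_cst].
      rewrite Ex_cst// lerD2l lerN2 ler_piMr//.
      by case/andP: (subdist_tsum (sd s)).
    apply: Ex_le => // [||t _]; [|exact: bounded_pay|].
      by apply: bounded_fnB; [exact: bounded_pay|exact: bounded_fn_cst].
    rewrite /pay; case: ifP => _; first lra.
    by case: ifP => _; [lra|exact: IHk].
  have h2 : l * reach_pay A d k.+1 s <= reach_pay A d k.+1 s.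
    by rewrite ler_piMl ?(andP l01).2// (andP r01').1.
  have h3 := (hd s).2.
  have h4 := ler_wpM2l (andP l01).1 h1.
  rewrite exprS; rewrite /eta in h3; rewrite /l in h2 h3 h4 *; nra.
have h1 := key n s0.
have h2 := bellman_iter_discount A n0 s0 l01.
have h3 := bellman_iter_le_lim A n0 s0 l01.
have h4 : 0 <= bellman_iter 1 A D n0 s0 <= 1.
  by apply: bellman_iter01; rewrite ler01 lexx.
have h5 : bellman_iter 1 A D n0 s0 - e / 3 <= l ^+ n0 * bellman_iter 1 A D n0 s0.
  nra.
rewrite -/(u s0) in h3; lra.
Qed.

End Operator.

(* Scaling a kernel by cut k leaves it on finitely many states only, and leaves
   free mass at each of them. *)
Definition cut (k : nat) (s : T) : R :=
  if (pickle s < k)%N then 1 - (k.+1%:R)^-1 else 0.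

Lemma cut01 k s : 0 <= cut k s <= 1.
Proof.
rewrite /cut; case: ifP => _; last by rewrite lexx ler01.
have : (k.+1%:R)^-1 <= 1 :> R by rewrite invf_le1 ?ltr0n// ler1n.
have : 0 < (k.+1%:R)^-1 :> R by rewrite invr_gt0 ltr0n.
by move: (_^-1) => y y0 y1; lra.
Qed.

Lemma cut_nd k s : cut k s <= cut k.+1 s.
Proof.
have := cut01 k.+1 s; rewrite /cut; case: (ltnP (pickle s) k) => h1; last by case/andP.
by rewrite (leq_trans h1)// => _; rewrite lerD2l lerN2 lef_pV2 ?posrE ?ltr0n// ler_nat.
Qed.

Lemma cut_cvg s : cut ^~ s @ \oo --> (1 : R).
Proof.
have : (fun k => 1 - (k.+1%:R)^-1 : R) @ \oo --> (1 - 0 : R).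
  by apply: cvgB; [exact: cvg_cst|exact: cvg_harmonic].
rewrite subr0; apply: cvg_trans; apply: near_eq_cvg.
by exists (pickle s).+1 => // k /= hk; rewrite /cut hk.
Qed.

Lemma subdistZ c b : 0 <= c <= 1 -> @subdist R T b -> subdist (fun t => c * b t).
Proof.
move=> /andP[c0 c1] [b0 b1]; split=> [t|n]; first by rewrite mulr_ge0.
by rewrite psumZ mulr_ile1// psum_ge0.
Qed.

(** As k grows the cut kernels increase to c pointwise, and Fatou carries the payoff to the limit
    one step of the horizon at a time. *)
Lemma reach_pay_cut A c n s e : (forall s, subdist (c s)) -> 0 < e ->
  exists k, reach_pay A c n s - e <= reach_pay A (fun s t => cut k s * c s t) n s.
Proof.
move=> sc e0; pose ck k s t := cut k s * c s t.
have sck k s' : subdist (ck k s') by apply: subdistZ => //; exact: cut01.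
have r01 k m t := reach_pay01 A m (sck k) t.
have rnd k m t : reach_pay A (ck k) m t <= reach_pay A (ck k.+1) m t.
  by apply: reach_pay_le => // u v; rewrite ler_wpM2r ?cut_nd//; exact: (sc u).1.
have main m t : reach_pay A c m t <= supn (fun k => reach_pay A (ck k) m t).
  elim: m t => [|m IHm] t.
    by apply: (@supn_ub _ (fun=> 0) 0) => _; rewrite lexx ler01.
  pose g v := supn (fun k => reach_pay A (ck k) m v).
  have g01 v : 0 <= g v <= 1 by apply: supn_itv.
  have c01 := reach_pay01 A m sc.
  apply: (@le_trans _ _ (Ex (c t) (pay A g t))).
    by apply: Ex_le => // [||v _]; [exact: bounded_pay..|exact: pay_le].
  apply: (@Ex_fatou _ _ (fun k => ck k t) (fun k => pay A (reach_pay A (ck k) m) t)) => //.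
  - by move=> k; exact: pay01.
  - exact: pay01.
  - move=> v; rewrite -[X in _ --> X]mul1r; apply: cvgM; first exact: cut_cvg.
    exact: cvg_cst.
  - by move=> v; exact: pay_supn.
  by move=> k; apply: (@supn_ub _ (fun k => reach_pay A (ck k) m.+1 t)).
have hs : has_sup (range (fun k => reach_pay A (ck k) n s)).
  split; first by eexists; exists 0%N.
  by exists 1 => _ [k _ <-]; case/andP: (r01 k n s).
have [_ [k _ <-] hk] := sup_adherent e0 hs.
exists k; have := main n s; rewrite /supn.
by move: hk; set S := sup _; lra.
Qed.

End Bellman.

(** * Fixing moves one finite set at a time *)

Section SubdistTheory.
Variables (R : realType) (T : countType).
Implicit Types b c : T -> R.

Lemma psumD b c n : psum (fun t => b t + c t) n = psum b n + psum c n.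
Proof. by rewrite /psum at_codeD -big_split. Qed.

Lemma tsumD b c : subdist b -> subdist c -> tsum (fun t => b t + c t) = tsum b + tsum c.
Proof.
move=> sb sc; rewrite /tsum at_codeD lim_seriesD//; exact: subdist_cvg.
Qed.

Lemma tsumZ x b : subdist b -> tsum (fun t => x * b t) = x * tsum b.
Proof. by move=> sb; rewrite -Ex1 ExZl ?Ex1//; exact: bounded_fn_cst. Qed.

Lemma subdistD b c : subdist b -> subdist c -> tsum b + tsum c <= 1 ->
  subdist (fun t => b t + c t).
Proof.
move=> sb sc h; split=> [t|n]; first by rewrite addr_ge0 ?sb.1 ?sc.1.
rewrite psumD; apply: le_trans h; apply: lerD; apply: psum_le_tsum.
- exact: sb.1.
- exact: subdist_cvg.
- exact: sc.1.
- exact: subdist_cvg.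
Qed.

Lemma subdist_term b t : subdist b -> 0 <= b t <= 1.
Proof.
move=> sb; rewrite sb.1/=; have /andP[_] := subdist_tsum sb; apply: le_trans.
by apply: term_le_tsum; [exact: sb.1|exact: subdist_cvg].
Qed.

End SubdistTheory.

Section Fixing.
Variables (R : realType) (M : mdp R) (w : M -> R).
Hypothesis w01 : forall t, 0 <= w t <= 1.
Let bw : bounded_fn w := bounded_itv w01.

(* A part, of mass k, of a move at s that does not decrease w on average. *)
Definition act (s : M) (k : R) (b : M -> R) : Prop :=
  [/\ subdist b, tsum b = k, forall t, ~~ trans s t -> b t = 0,
      ~~ controlled s -> forall t, b t = k * prob s t & k * w s <= Ex b w].

Lemma actD s k l b c : act s k b -> act s l c -> k + l <= 1 ->
  act s (k + l) (fun t => b t + c t).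
Proof.
move=> [sb mb tb rb eb] [sc mc tc rc ec] kl; split.
- by apply: subdistD => //; rewrite mb mc.
- by rewrite tsumD// mb mc.
- by move=> t nt; rewrite tb// tc// addr0.
- by move=> ns t; rewrite rb// rc// mulrDl.
by rewrite mulrDl ExDl// lerD.
Qed.

Lemma actZ s x k b : 0 <= x <= 1 -> act s k b -> act s (x * k) (fun t => x * b t).
Proof.
move=> x01 [sb mb tb rb eb]; split.
- exact: subdistZ.
- by rewrite tsumZ// mb.
- by move=> t nt; rewrite tb// mulr0.
- by move=> ns t; rewrite rb// mulrA.
by rewrite -mulrA ExZl// ler_wpM2l//; case/andP: x01.
Qed.

(** Mass and average of w pass to the limit: every [b_ n] lies below it, and Fatou bounds its mass
    from above. *)
Lemma act_lim s (k_ : nat -> R) (b_ : nat -> M -> R) :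
  (forall n, act s (k_ n) (b_ n)) -> (forall n t, b_ n t <= b_ n.+1 t) ->
  (forall n, 0 <= k_ n <= 1) -> (forall n, k_ n <= k_ n.+1) ->
  act s (supn k_) (fun t => supn (b_ ^~ t)).
Proof.
move=> ab nb k01 nk; pose b t := supn (b_ ^~ t).
have sb_ n : subdist (b_ n) by case: (ab n).
have b01 n t : 0 <= b_ n t <= 1 by exact: subdist_term.
have bcvg t : b_ ^~ t @ \oo --> b t by exact: supn_cvg.
have bub n t : b_ n t <= b t by apply: (@supn_ub _ (b_ ^~ t)).
have sb : subdist b.
  split=> [t|n]; first by case/andP: (supn_itv (b01^~ t)).
  by apply: (@psum_fatou _ _ b_) => // m; case: (sb_ m).
split => //.
- apply/eqP; rewrite eq_le; apply/andP; split.
    apply: tsum_le; first exact: subdist_cvg.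
    move=> n; apply: (@psum_fatou _ _ b_) => // m; case: (ab m) => _ e _ _ _.
    apply: (@le_trans _ _ (tsum (b_ m))).
      by apply: psum_le_tsum; [exact: (sb_ m).1|exact: subdist_cvg].
    by rewrite e; exact: supn_ub.
  apply: supn_le => n; case: (ab n) => _ <- _ _ _; rewrite -!Ex1.
  by apply: Ex_lel => //; exact: bounded_fn_cst.
- move=> t nt; apply/eqP; rewrite eq_le; apply/andP; split; last first.
    by case/andP: (supn_itv (b01^~ t)).
  by apply: supn_le => n; case: (ab n) => _ _ /(_ _ nt) -> _ _.
- move=> ns t; rewrite -/(b t) -(cvg_lim _ (bcvg t))//; apply/cvg_lim => //.
  rewrite (_ : b_ ^~ t = (fun n => k_ n * prob s t)); last first.
    by apply/funext => n; case: (ab n) => _ _ _ /(_ ns) -> _.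
  by apply: cvgM; [exact: supn_cvg|exact: cvg_cst].
have w0 t : 0 <= w t by case/andP: (w01 t).
have [->|ws0] := eqVneq (w s) 0; first by rewrite mulr0; exact: Ex_ge0.
have wp : 0 < w s by rewrite lt_def ws0 w0.
rewrite -ler_pdivlMr//; apply: supn_le => n; rewrite ler_pdivlMr//.
by case: (ab n) => _ _ _ _ h; apply: le_trans h _; exact: Ex_lel.
Qed.

Hypothesis act_neq0 : forall s, exists d, act s 1 d.
(** Together with the drift condition in [act], this makes w preserved exactly on average at states
    of positive weight. *)
Hypothesis act_le : forall s d, act s 1 d -> w s != 0 -> Ex d w <= w s.

Definition acts (s : M) : set (M -> R) := [set d | act s 1 d].

Let acts_subdist s d : acts s d -> subdist d. Proof. by case. Qed.

(* The part b s of the move at s is already fixed, and the mass m s is still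
   free; it is the whole mass at all but finitely many states. *)
Definition partial (b : M -> M -> R) (m : M -> R) (N : nat) : Prop :=
  forall s, [/\ 0 < m s <= 1, act s (1 - m s) (b s) & (N <= pickle s)%N -> m s = 1].

Definition completions (b : M -> M -> R) (m : M -> R) (s : M) : set (M -> R) :=
  [set d' | exists2 d, act s 1 d & d' = (fun t => b s t + m s * d t)].

Lemma partial_act b m N s d : partial b m N -> act s 1 d ->
  act s 1 (fun t => b s t + m s * d t).
Proof.
move=> /(_ s) [m01 ab _] ad; have /andP[m0 m1] := m01.
have -> : (1 : R) = (1 - m s) + m s * 1 by lra.
apply: actD => //; last lra.
by apply: actZ => //; rewrite m1 ltW.
Qed.

(** Every payment is w at the state reached, and w does not increase on average at states where
    payments are possible. *)
Lemma bellman_iter_le_weight A n s : bellman_iter w 1 A acts n s <= w s.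
Proof.
have l11 : 0 <= (1 : R) <= 1 by rewrite ler01 lexx.
have w0 t : 0 <= w t by case/andP: (w01 t).
elim: n s => [|n IHn] s //=; rewrite mul1r; apply: bellman_le => // d ad.
have i01 t := bellman_iter01 w01 acts_subdist act_neq0 A n t l11.
have [sd _ _ _ _] := ad.
have [ws0|ws0] := eqVneq (w s) 0.
  have -> : pay w A (bellman_iter w 1 A acts n) s = fun=> 0.
    by apply/funext => t; rewrite /pay ws0 eqxx.
  by rewrite Ex_cst// mul0r.
apply: le_trans (act_le ad ws0); apply: Ex_le => //.
  exact: bounded_pay.
by move=> t _; rewrite /pay; case: ifP => // _; case: ifP.
Qed.

(** * Fixing a part of the moves at finitely many states keeps the value *)

Section PartialValue.
Variables (A : set (M * M)).
Hypothesis hv : forall s e, 0 < e -> exists n, w s - e <= bellman_iter w 1 A acts n s.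
Variables (b : M -> M -> R) (m : M -> R) (N : nat).
Hypothesis pb : partial b m N.

Let l11 : 0 <= (1 : R) <= 1. Proof. by rewrite ler01 lexx. Qed.
Let w0 t : 0 <= w t. Proof. by case/andP: (w01 t). Qed.

Let c_subdist s d : completions b m s d -> subdist d.
Proof. by move=> [d' ad ->]; case: (partial_act pb ad). Qed.

Let c_neq0 s : exists d, completions b m s d.
Proof. by have [d ad] := act_neq0 s; eexists; exists d. Qed.

Let v n := bellman_iter w 1 A acts n.
Let u := bellman_lim w (completions b m) 1 A.

Let v01 n t : 0 <= v n t <= 1 := bellman_iter01 w01 acts_subdist act_neq0 A n t l11.
Let u01 t : 0 <= u t <= 1 := bellman_lim01 w01 c_subdist c_neq0 A t l11.

(** Only finitely many states have code below N, so a maximum of horizons works; half of w is asked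
    for, since w itself may be approached only in the limit. *)
Lemma uniform_horizon :
  exists n, forall s, (pickle s < N)%N -> w s / 2 <= v n s.
Proof.
elim: N => [|k [n hn]]; first by exists 0%N.
have hk : exists n', forall s, pickle s = k -> w s / 2 <= v n' s.
  case e : (@pickle_inv M k) => [s|]; last first.
    by exists 0%N => s hs; rewrite -hs pickleK_inv in e.
  have [n' hn'] : exists n', w s / 2 <= v n' s.
    have [ws0|ws0] := eqVneq (w s) 0.
      by exists 0%N; rewrite ws0 mul0r; case/andP: (v01 0 s).
    have wp : 0 < w s / 2 by rewrite divr_gt0// lt_def ws0 w0.
    have [n' hn'] := hv s wp; exists n'; apply: le_trans hn'; lra.
  exists n' => s' hs'; move: e; rewrite -hs' pickleK_inv => -[->]; exact: hn'.
have [n' hn'] := hk.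
have mono i j s : (i <= j)%N -> v i s <= v j s.
  by move=> ij; exact: bellman_iter_mono.
exists (maxn n n') => s; rewrite ltnS leq_eqVlt => /orP[/eqP/hn'|/hn] h.
  by apply: le_trans h _; apply: mono; exact: leq_maxr.
by apply: le_trans h _; apply: mono; exact: leq_maxl.
Qed.

(** The free mass is positive everywhere and equal to 1 outside finitely many states, hence bounded
    away from 0. *)
Lemma uniform_freedom : exists2 mu, 0 < mu <= 1 & forall s, mu <= m s.
Proof.
have [mu mu01 hmu] : exists2 mu, 0 < mu <= 1 &
    forall s, (pickle s < N)%N -> mu <= m s.
  elim: N => [|k [mu mu01 hmu]]; first by exists 1; rewrite ?ltr01 ?lexx.
  case e : (@pickle_inv M k) => [s|]; last first.
    exists mu => // s; rewrite ltnS leq_eqVlt => /orP[/eqP hs|/hmu//].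
    by rewrite -hs pickleK_inv in e.
  have [m01 _ _] := pb s.
  exists (Num.min mu (m s)); first by rewrite lt_min ge_min; move: mu01 m01; lra.
  move=> s'; rewrite ltnS leq_eqVlt => /orP[/eqP hs|/hmu h].
    by move: e; rewrite -hs pickleK_inv => -[->]; rewrite ge_min lexx orbT.
  by rewrite ge_min h.
exists mu => // s; case: (ltnP (pickle s) N) => [/hmu//|h].
by have [_ _ /(_ h) ->] := pb s; case/andP: mu01.
Qed.

(** Excessivity of u for a completed move, with the fixed and the free part of the move
    separated. *)
Lemma completion_excessive s d : act s 1 d ->
  Ex (b s) (pay w A u s) + m s * Ex d (pay w A u s) <= u s.
Proof.
move=> ad; have [m01 [sb _ _ _ _] _] := pb s; have [sd _ _ _ _] := ad.
have [m0 m1] := andP m01.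
have : completions b m s (fun t => b s t + m s * d t) by exists d.
move/(bellman_lim_excessive w01 c_subdist c_neq0 A); rewrite -/u.
rewrite ExDl//; first by rewrite ExZl//; exact: bounded_pay.
- by apply: subdistZ => //; rewrite ltW.
exact: bounded_pay.
Qed.

(* Following for n steps, with the free mass only, a strategy of the
   unconstrained game gains a fraction mu ^ n of what is missing from w. *)
Lemma value_boost k mu n s : 0 <= k <= 1 -> 0 < mu <= 1 ->
  (forall s, mu <= m s) -> (forall s, k * w s <= u s) ->
  k * w s + (1 - k) * mu ^+ n * v n s <= u s.
Proof.
move=> k01 mu01 hmu hk; elim: n s => [|n IHn] s.
  by rewrite /v /= mulr0 addr0.
have [ws0|ws0] := eqVneq (w s) 0.
  have := bellman_iter_le_weight A n.+1 s; rewrite ws0 -/(v _ _) => vle.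
  have -> : v n.+1 s = 0 by apply/le_anti; rewrite vle; case/andP: (v01 n.+1 s).
  by rewrite !mulr0 addr0; case/andP: (u01 s).
have mun : 0 <= mu ^+ n <= 1.
  by rewrite exprn_ge0 ?exprn_ile1//; case/andP: mu01 => /ltW.
apply/le_eps => e e0.
have [d ad hd] := bellman_adherent w01 acts_subdist act_neq0 A s (v01 n) e0.
rewrite /v /= mul1r -/(v n); set B := bellman _ _ _ _ _ in hd *.
have [sd _ _ _ wd] := ad.
have [m01 [sb mb _ _ wb] _] := pb s.
have h0 := completion_excessive ad.
have pu := bounded_pay w01 A s u01.
have pv := bounded_pay w01 A s (v01 n).
(* The fixed part does not decrease w on average either, and on it only the bound k * w <= u is
   used; the gain comes from the free part, in [h2]. *)
have h1 : k * ((1 - m s) * w s) <= Ex (b s) (pay w A u s).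
  apply: (@le_trans _ _ (k * Ex (b s) w)); first by rewrite ler_wpM2l//; case/andP: k01.
  rewrite -ExZ//; apply: Ex_le => //; first exact: bounded_fnZ.
  move=> t _; rewrite /pay (negbTE ws0); case: ifP => // _.
  by rewrite ler_piMl//; case/andP: k01.
have h2 : k * w s + (1 - k) * mu ^+ n * Ex d (pay w A (v n) s) <= Ex d (pay w A u s).
  apply: (@le_trans _ _ (k * Ex d w + (1 - k) * mu ^+ n * Ex d (pay w A (v n) s))).
    by rewrite lerD2r ler_wpM2l//; [case/andP: k01|rewrite mul1r in wd].
  rewrite -!ExZ// -ExD//; [|exact: bounded_fnZ..].
  apply: Ex_le => //; first by apply: bounded_fnD; exact: bounded_fnZ.
  move=> t _; rewrite /pay (negbTE ws0); case: ifP => // _.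
  have x1 : (1 - k) * mu ^+ n <= 1 - k by rewrite ler_piMr//; lra.
  have := ler_wpM2r (w0 t) x1; lra.
have hm := hmu s.
rewrite exprS.
set a := (1 - k) * mu ^+ n in h2; set X := Ex d _ in h0 h2; set Y := Ex (b s) _ in h0 h1.
set Z := Ex d _ in h2 hd.
have a01 : 0 <= a <= 1 by rewrite /a mulr_ge0 ?mulr_ile1//; lra.
have -> : (1 - k) * (mu * mu ^+ n) = mu * a by rewrite /a; ring.
have m0 : 0 <= m s by lra.
have Z0 : 0 <= Z.
  by have := Ex_itv sd (pay01 w01 A s (v01 n)); case/andP.
have h3 := ler_wpM2l m0 h2.
(* The free mass at s is at least mu, which accounts for the extra factor mu of this step. *)
have h4 : mu * (a * Z) <= m s * (a * Z) by rewrite ler_wpM2r// mulr_ge0//; lra.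
have h5 : mu * a * (B - e) <= mu * a * Z.
  by rewrite ler_wpM2l// mulr_ge0//; lra.
have h6 : mu * a * e <= e.
  by rewrite ler_piMl//; [lra|rewrite mulr_ile1//; lra].
have -> : k * w s = k * ((1 - m s) * w s) + m s * (k * w s) by ring.
move: h3; rewrite mulrDr; move: h5; rewrite mulrBr; lra.
Qed.

(** A bound k * w <= u improves to the factor k + (1 - k) * d with d independent of k, so that 1 - k
    shrinks geometrically and the factor tends to 1. *)
Lemma partial_value s : w s <= u s.
Proof.
have [n hn] := uniform_horizon; have [mu mu01 hmu] := uniform_freedom.
(* The factor mu ^ n is the cost of staying in the free mass for n steps, and 1/2 comes from
   [uniform_horizon]. *)
pose d := mu ^+ n / 2.
have mun : 0 < mu ^+ n <= 1.
  by rewrite exprn_gt0 ?exprn_ile1//; case/andP: mu01 => // /ltW.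
have d01 : 0 < d < 1 by rewrite /d; lra.
(* The gain of value_boost is uniform at the finitely many states with fixed
   moves, and spreads to the others by playing freely until reaching them. *)
have step k : 0 <= k <= 1 -> (forall s, k * w s <= u s) ->
    forall s, (k + (1 - k) * d) * w s <= u s.
  move=> k01 hk; pose k' := k + (1 - k) * d.
  have k'01 : 0 <= k' <= 1 by rewrite /k'; nra.
  have onF s' : (pickle s' < N)%N -> k' * w s' <= u s'.
    move=> /hn h; apply: le_trans (value_boost n s' k01 mu01 hmu hk).
    have h' : (1 - k) * mu ^+ n * (w s' / 2) <= (1 - k) * mu ^+ n * v n s'.
      by apply: ler_wpM2l => //; rewrite mulr_ge0//; lra.
    by apply: le_trans (lerD (lexx _) h'); rewrite /k' /d; lra.
  have every j s' : k' * v j s' <= u s'.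
    elim: j s' => [|j IHj] s'; first by rewrite /v /= mulr0; case/andP: (u01 s').
    have vle := bellman_iter_le_weight A j.+1 s'.
    case: (ltnP (pickle s') N) => [/onF|hs].
      by apply: le_trans; rewrite ler_wpM2l//; case/andP: k'01.
    have [ws0|ws0] := eqVneq (w s') 0.
      have -> : v j.+1 s' = 0.
        by apply/le_anti; rewrite -{1}ws0 vle; case/andP: (v01 j.+1 s').
      by rewrite mulr0; case/andP: (u01 s').
    apply/le_eps => e e0.
    have [c ac hc] := bellman_adherent w01 acts_subdist act_neq0 A s' (v01 j) e0.
    have [sc _ _ _ _] := ac.
    have [m01 [sb mb _ _ _] /(_ hs) ms1] := pb s'.
    have h0 := completion_excessive ac; rewrite ms1 mul1r in h0.
    have h1 : 0 <= Ex (b s') (pay w A u s').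
      by case/andP: (Ex_itv sb (pay01 w01 A s' u01)).
    have h2 : k' * Ex c (pay w A (v j) s') <= Ex c (pay w A u s').
      rewrite -ExZ//; last exact: bounded_pay.
      apply: Ex_le => //; [exact/bounded_fnZ/bounded_pay|exact: bounded_pay|].
      move=> t _; rewrite /pay (negbTE ws0); case: ifP => // _.
      by rewrite ler_piMl//; case/andP: k'01.
    have h3 := ler_wpM2l (andP k'01).1 hc; rewrite mulrBr in h3.
    have h4 : k' * e <= e by rewrite ler_piMl//; lra.
    rewrite {1}/v /= mul1r -/(v j); lra.
  move=> s'; apply/le_eps => e e0; have [j hj] := hv s' e0.
  apply: le_trans (every j s').
  have := ler_wpM2l (andP k'01).1 hj; rewrite mulrBr -/(v j s').
  have : k' * e <= e by rewrite ler_piMl//; lra.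
  rewrite -/k'; lra.
have it j : forall s, (1 - (1 - d) ^+ j) * w s <= u s.
  elim: j => [|j IHj] s'; first by rewrite expr0 subrr mul0r; case/andP: (u01 s').
  have q01 : 0 <= (1 - d) ^+ j <= 1 by rewrite exprn_ge0 ?exprn_ile1//; lra.
  have -> : 1 - (1 - d) ^+ j.+1 = (1 - (1 - d) ^+ j) + (1 - (1 - (1 - d) ^+ j)) * d.
    by rewrite exprS; ring.
  by apply: step => //; lra.
apply/le_eps => e e0.
have [j hj] : exists j, (1 - d) ^+ j <= e by apply: expr_small => //; lra.
apply: le_trans (it j s); rewrite mulrBl mul1r lerD2l lerN2.
by apply: le_trans hj; rewrite ler_piMr ?exprn_ge0//; [lra|case/andP: (w01 s)].
Qed.

(** One stage of the construction: three losses of e / 3 come from a finite horizon, from a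
    stationary choice, and from the cut to finitely many states. *)
Lemma partial_extend s0 e : 0 < e -> exists b' m' N' n,
  [/\ partial b' m' N', forall s t, b s t <= b' s t, forall s, m' s <= m s &
      w s0 - e <= reach_pay w A b' n s0].
Proof.
move=> e0; have e3 : 0 < e / 3 by rewrite divr_gt0.
have [n0 hn0] : exists n0, w s0 - e / 3 <= bellman_iter w 1 A (completions b m) n0 s0.
  have := partial_value s0; rewrite /u /bellman_lim /supn => h.
  have hs : has_sup (range (fun n => bellman_iter w 1 A (completions b m) n s0)).
    split; first by eexists; exists 0%N.
    exists 1 => _ [n _ <-].
    by case/andP: (bellman_iter01 w01 c_subdist c_neq0 A n s0 l11).
  have [_ [n _ <-] /ltW hn] := sup_adherent e3 hs.
  by exists n; apply: le_trans hn; rewrite lerD2r.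
have [c [hc [n hn]]] := stationary_near_optimal w01 c_subdist c_neq0 A n0 s0 e3.
have sc s : subdist (c s) := c_subdist (hc s).
have [k hk] := reach_pay_cut w01 A n s0 sc e3.
have /choice[d hd] : forall s, exists d, act s 1 d /\ c s = (fun t => b s t + m s * d t).
  by move=> s; have [d ad ->] := hc s; exists d.
(* This is the free fraction that [cut] leaves at states with code below k. *)
pose x : R := (k.+1%:R)^-1.
have x01 : 0 < x <= 1.
  by rewrite invr_gt0 ltr0n invf_le1 ?ltr0n// ler1n.
pose b' s t := if (pickle s < k)%N then b s t + (1 - x) * m s * d s t else b s t.
pose m' s := if (pickle s < k)%N then x * m s else m s.
have bb' s t : b s t <= b' s t.
  rewrite /b'; case: ifP => // _; rewrite lerDl.
  have [[sd _ _ _ _] _] := hd s; have [m01 _ _] := pb s.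
  by rewrite !mulr_ge0 ?sd.1//; lra.
have pb' : partial b' m' (maxn N k).
  move=> s; have [/andP[m0 m1] ab mN] := pb s; split.
  - rewrite /m'; case: ifP => _; last by rewrite m0.
    by rewrite mulr_gt0 ?mulr_ile1//; lra.
  - rewrite /m' /b'; case: ifP => _ //.
    have -> : 1 - x * m s = (1 - m s) + (1 - x) * m s * 1 by ring.
    apply: actD => //; last by nra.
    apply: actZ; last exact: (hd s).1.
    by rewrite mulr_ge0 ?mulr_ile1//; lra.
  - rewrite geq_max => /andP[h1 h2]; rewrite /m' ltnNge h2 /=; exact: mN.
exists b', m', (maxn N k), n; split => //.
- move=> s; rewrite /m'; case: ifP => // _; have [m01 _ _] := pb s.
  by rewrite ler_piMl//; lra.
have sb' s : subdist (b' s) by have [_ [] ] := pb' s.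
have sb s : subdist (b s) by have [_ [] ] := pb s.
(* The new fixed part dominates the cut kernel: it keeps all of b, whereas the cut also shrinks b by
   the factor 1 - x. *)
have h : reach_pay w A (fun s t => cut R k s * c s t) n s0 <= reach_pay w A b' n s0.
  apply: reach_pay_le => // [s|s t]; first by apply: subdistZ => //; exact: cut01.
  have [_ cs] := hd s; rewrite cs /cut /b' -/x; case: ifP => _; last first.
    by rewrite mul0r; exact: (sb s).1.
  rewrite mulrDr mulrA lerD2r ler_piMl//; last lra.
  exact: (sb s).1.
lra.
Qed.

End PartialValue.

Variable A : nat -> set (M * M).
Hypothesis hvA : forall i s e, 0 < e ->
  exists n, w s - e <= bellman_iter w 1 (A i) acts n s.

(** Fixed parts only grow from stage to stage, so what the fixed part alone earns at one stage is
    also earned by the limit. *)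
Theorem stationary_reach_all : exists sigma : M -> M -> R,
  (forall s, act s 1 (sigma s)) /\
  forall i s e, 0 < e -> exists n, w s - e <= reach_pay w (A i) sigma n s.
Proof.
pose state := {x : (M -> M -> R) * (M -> R) | exists N, partial x.1 x.2 N}.
have nxt (q : nat * state) : exists q' : state,
   [/\ forall s t, (sval q.2).1 s t <= (sval q').1 s t,
       forall s, (sval q').2 s <= (sval q.2).2 s &
       forall i s j, unpickle q.1 = Some (i, s, j) ->
         exists n, w s - (j.+1%:R)^-1 <= reach_pay w (A i) (sval q').1 n s].
  case: q => k [[b m] /= [N pb]].
  (* Stage k treats the triple coded by k, with error 1 / (j + 1); a number that codes no triple
     changes nothing. *)
  case: (@unpickle (nat * M * nat)%type k) => [[[i s] j]|]; last first.
    by exists (exist _ (b, m) (ex_intro _ N pb)).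
  have j0 : 0 < (j.+1%:R)^-1 :> R by rewrite invr_gt0 ltr0n.
  have [b' [m' [N' [n [pb' bb' mm' h]]]]] := partial_extend (hvA i) pb s j0.
  exists (exist _ (b', m') (ex_intro _ N' pb')); split => //= i' s' j' [<- <- <-].
  by exists n.
have [F hF] := choice nxt.
have p0 : partial (fun _ _ => 0) (fun=> 1) 0.
  move=> s; split => //; first by rewrite ltr01 lexx.
  have [d ad] := act_neq0 s; have z01 : 0 <= (0 : R) <= 1 by rewrite lexx ler01.
  have := actZ z01 ad; rewrite mul0r subrr; congr act.
  by apply/funext => t; rewrite mul0r.
pose x0 : state := exist _ (fun _ _ => 0, fun=> 1) (ex_intro _ 0%N p0).
pose fix st k : state := if k is k'.+1 then F (k', st k') else x0.
pose b_ k := (sval (st k)).1; pose m_ k := (sval (st k)).2.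
have pb k : exists N, partial (b_ k) (m_ k) N := svalP (st k).
have bnd k s t : b_ k s t <= b_ k.+1 s t by have [h _ _] := hF (k, st k); exact: h.
have mni k s : m_ k.+1 s <= m_ k s by have [_ h _] := hF (k, st k); exact: h.
have m01 k s : 0 < m_ k s <= 1 by have [N /(_ s)[]] := pb k.
have ab k s : act s (1 - m_ k s) (b_ k s) by have [N /(_ s)[]] := pb k.
have sb k s : subdist (b_ k s) by case: (ab k s).
have k01 s n : 0 <= 1 - m_ n s <= 1 by have := m01 n s; lra.
have abl s : act s (supn (fun k => 1 - m_ k s)) (fun t => supn (fun k => b_ k s t)).
  by apply: (@act_lim s (fun k => 1 - m_ k s) (fun k => b_ k s)) => // n; rewrite lerD2l lerN2.
have /choice[a ha] := act_neq0.
pose kl s := supn (fun k => 1 - m_ k s).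
have kl01 s : 0 <= kl s <= 1 by exact: supn_itv.
(* Mass that is still free in the limit is spent on an arbitrary allowed move. *)
exists (fun s t => supn (fun k => b_ k s t) + (1 - kl s) * a s t).
have asig s : act s 1 (fun t => supn (fun k => b_ k s t) + (1 - kl s) * a s t).
  have e1 : 1 = kl s + (1 - kl s) * 1 by lra.
  rewrite [X in act _ X _]e1.
  by apply: actD => //; [apply: actZ => //; have := kl01 s; lra|lra].
split => // i s e e0.
have [j hj] : exists j, (j.+1%:R)^-1 <= e.
  have /cvgrPdist_lt /(_ _ e0) [j _ hj] := @cvg_harmonic R.
  exists j; move: (hj j (leqnn j)) => /=; rewrite sub0r normrN ger0_norm ?invr_ge0//.
  exact: ltW.
pose k := pickle (i, s, j).
have [_ _ /(_ i s j (pickleK _)) [n hn]] := hF (k, st k).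
exists n; apply: le_trans (_ : w s - (j.+1%:R)^-1 <= _); first by rewrite lerD2l lerN2.
apply: le_trans hn _; apply: reach_pay_le => // [s'|s'|s' t].
- exact: (sb k.+1 s').
- by case: (asig s').
have [sa _ _ _ _] := ha s'.
rewrite -[X in X <= _]addr0; apply: lerD.
  apply: (@supn_ub _ (fun k => b_ k s' t) k.+1) => n'.
  exact: subdist_term.
by rewrite mulr_ge0 ?sa.1//; have := kl01 s'; lra.
Qed.

End Fixing.

(** * Plans and the value of the objective *)

Section EsumSeries.
Variables (R : realType) (T : countType).
Implicit Types (f : T -> R) (D : set T).

Lemma esum_at_code f D : (forall t, 0 <= f t) -> (forall t, ~ D t -> f t = 0) ->
  (\esum_(t in D) (f t)%:E = \sum_(k <oo) (at_code f k)%:E)%E.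
Proof.
move=> f0 fD; rewrite nneseries_esumT; last first.
  by move=> k; rewrite lee_fin at_code_ge0.
transitivity (\esum_(t in [set: T]) (f t)%:E)%E.
  rewrite esum_mkcond; apply: eq_esum => t _.
  by case: ifPn => //; rewrite notin_setE => /fD ->.
rewrite [RHS](esum_mkcond _ _).
transitivity (\esum_(k in range (@pickle T)) (at_code f k)%:E)%E; last first.
  rewrite esum_mkcond; apply: eq_esum => k _.
  case: ifPn => [_|]; first by rewrite mem_setT.
  rewrite notin_setE /= mem_setT => hk; rewrite /at_code.
  case e : pickle_inv => [t|] //=; exfalso; apply: hk; exists t => //.
  by have := @pickle_invK T k; rewrite e.
rewrite (reindex_esum [set: T] (range (@pickle T)) (@pickle T)).
- by apply: eq_esum => t _; rewrite at_code_pickle.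
- split=> [t _||]; [by exists t| |by []].
  by move=> s t _ _ /(pcan_inj (@pickleK_inv T)).
Qed.

Lemma nneseries_tsum f : (forall t, 0 <= f t) -> cvgn (series (at_code f)) ->
  (\sum_(k <oo) (at_code f k)%:E = (tsum f)%:E)%E.
Proof.
move=> f0 cf; rewrite -EFin_lim//; congr (limn _); apply/funext => n /=.
by rewrite sumEFin.
Qed.

Lemma distribution_subdist D f :
  distribution_on D f <-> [/\ subdist f, tsum f = 1 & forall t, ~ D t -> f t = 0].
Proof.
split=> [[f0 fD f1]|[sf f1 fD]].
  rewrite esum_at_code// in f1.
  have sf : subdist f.
    split=> // n; rewrite -lee_fin -f1 /psum -sumEFin.
    by apply: nneseries_lim_ge => k _; rewrite lee_fin at_code_ge0.
  split => //; apply: EFin_inj; rewrite -f1 nneseries_tsum//.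
  exact: subdist_cvg.
have [f0 _] := sf; have cf := subdist_cvg sf.
by split => //; rewrite esum_at_code// nneseries_tsum// f1.
Qed.

End EsumSeries.

(** * Plans and their hitting probabilities *)

Section Plans.
Variables (R : realType) (M : mdp R).
Implicit Types (x y : seq M -> M -> M -> R) (d : M -> R) (B : set (M * M)).

Definition valid (s : M) d : Prop :=
  [/\ subdist d, tsum d = 1, forall t, ~~ trans s t -> d t = 0 &
      ~~ controlled s -> forall t, d t = prob s t].

(* A plan is a strategy that also prescribes the moves at random states, and is
   constrained on all pairs (h, s), not only on histories. *)
Definition plan x : Prop := forall h s, valid s (x h s).

Definition shift x (s : M) h := x (s :: h).

Lemma plan_shift x s : plan x -> plan (shift x s).
Proof. by move=> px h t; exact: px. Qed.

(** At a controlled state a point mass on some successor serves. *)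
Lemma valid_default s : exists d, valid s d.
Proof.
case: (boolP (controlled s)) => cs; last first.
  exists (prob s).
  have /distribution_subdist[sp p1 pD] := prob_distr cs.
  by split => // t /negP; exact: pD.
have [t0 st0] := trans_total s; pose d t : R := (t == t0)%:R.
have d0 t : 0 <= d t by rewrite ler0n.
have hp n : psum d n = if (pickle t0 < n)%N then 1 else 0.
  elim: n => [|n IHn]; first by rewrite /psum big_nil.
  rewrite /psum big_nat_recr//= [X in X + _]IHn [in RHS]ltnS [in RHS]leq_eqVlt.
  have [<-|nt] := eqVneq (pickle t0) n.
    by rewrite ltnn at_code_pickle /d eqxx add0r.
  rewrite /at_code; case e : pickle_inv => [t|] /=; rewrite ?addr0//.
  have := @pickle_invK M n; rewrite e /= => et.
  by rewrite /d; case: eqP => [tt0|_]; [rewrite -et tt0 eqxx in nt|rewrite addr0].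
have sd : subdist d.
  by split=> // n; rewrite hp; case: ifP => _; rewrite ?ler01.
exists d; split => //; last by rewrite cs.
- apply/eqP; rewrite eq_le; case/andP: (subdist_tsum sd) => _ -> /=.
  have := psum_le_tsum (pickle t0).+1 sd.1 (subdist_cvg sd).
  by rewrite hp leqnn.
- by move=> t; rewrite /d; case: eqP => // ->; rewrite st0.
Qed.

(** The probability of a B-edge among the first m transitions, by recursion on the first step, so
    that plans are optimized without measures on runs; [law_hit_after] gives the agreement with the
    law. *)
Fixpoint hit B m x (s : M) : R :=
  if m is m'.+1 then
    Ex (x [::] s) (fun t => if `[< B (s, t) >] then 1 else hit B m' (shift x s) t)
  else 0.

(** The window consists of the transitions n, ..., n + m - 1. *)
Fixpoint hit_after B n m x (s : M) : R :=
  if n is n'.+1 then Ex (x [::] s) (hit_after B n' m (shift x s)) else hit B m x s.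

Definition hit_ever B n x s := supn (fun m => hit_after B n m x s).

Let if01 B s (g : M -> R) : (forall t, 0 <= g t <= 1) ->
  forall t, 0 <= (if `[< B (s, t) >] then 1 else g t) <= 1.
Proof. by move=> g01 t; case: ifP => // _; rewrite ler01 lexx. Qed.

Let valid_subdist s d : valid s d -> subdist d. Proof. by case. Qed.

Lemma hit01 B m x s : plan x -> 0 <= hit B m x s <= 1.
Proof.
elim: m x s => [|m IHm] x s px /=; first by rewrite lexx ler01.
apply: Ex_itv; first exact: valid_subdist (px [::] s).
by apply: if01 => t; apply: IHm; exact: plan_shift.
Qed.

Lemma hit_nd B m x s : plan x -> hit B m x s <= hit B m.+1 x s.
Proof.
elim: m x s => [|m IHm] x s px; first by case/andP: (hit01 B 1 s px).
have pxs := plan_shift s px.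
apply: Ex_le; first exact: valid_subdist (px [::] s).
- by apply/bounded_itv/if01 => t; exact: hit01.
- by apply/bounded_itv/if01 => t; exact: (hit01 B m.+1).
- by move=> t _; case: ifP => // _; exact: IHm.
Qed.

Lemma hit_sub B B' m x s : plan x -> B `<=` B' -> hit B m x s <= hit B' m x s.
Proof.
move=> + BB'; elim: m x s => //= m IHm x s px.
have pxs := plan_shift s px.
apply: Ex_le; first exact: valid_subdist (px [::] s).
- by apply/bounded_itv/if01 => t; exact: hit01.
- by apply/bounded_itv/if01 => t; exact: hit01.
- move=> t _; case: ifPn => [/asboolP/BB' b|_]; first by rewrite asboolT.
  by case: ifP => _; [case/andP: (hit01 B m t pxs)|exact: IHm].
Qed.

Lemma hit_after01 B n m x s : plan x -> 0 <= hit_after B n m x s <= 1.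
Proof.
elim: n x s => [|n IHn] x s px /=; first exact: hit01.
apply: Ex_itv; first exact: valid_subdist (px [::] s).
by move=> t; apply: IHn; exact: plan_shift.
Qed.

Lemma hit_after_nd B n m x s : plan x -> hit_after B n m x s <= hit_after B n m.+1 x s.
Proof.
elim: n x s => [|n IHn] x s px /=; first exact: hit_nd.
have pxs := plan_shift s px.
apply: Ex_le; first exact: valid_subdist (px [::] s).
- by apply: bounded_itv => t; exact: hit_after01.
- by apply: bounded_itv => t; exact: hit_after01.
- by move=> t _; exact: IHn.
Qed.

Lemma hit_after_sub B B' n m x s : plan x -> B `<=` B' ->
  hit_after B n m x s <= hit_after B' n m x s.
Proof.
move=> + BB'; elim: n x s => [|n IHn] x s px /=; first exact: hit_sub.
have pxs := plan_shift s px.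
apply: Ex_le; first exact: valid_subdist (px [::] s).
- by apply: bounded_itv => t; exact: hit_after01.
- by apply: bounded_itv => t; exact: hit_after01.
- by move=> t _; exact: IHn.
Qed.

Lemma hit_ever01 B n x s : plan x -> 0 <= hit_ever B n x s <= 1.
Proof. by move=> px; apply: supn_itv => m; exact: hit_after01. Qed.

Lemma hit_after_le_ever B n m x s : plan x -> hit_after B n m x s <= hit_ever B n x s.
Proof.
move=> px; apply: (@supn_ub _ (fun m => hit_after B n m x s)) => k.
exact: hit_after01.
Qed.

Lemma hit_ever_sub B B' n x s : plan x -> B `<=` B' ->
  hit_ever B n x s <= hit_ever B' n x s.
Proof.
move=> px BB'; apply: supn_le => m; apply: le_trans (hit_after_sub n m s px BB') _.
exact: hit_after_le_ever.
Qed.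

Lemma hit_everS B n x s : plan x ->
  hit_ever B n.+1 x s = Ex (x [::] s) (hit_ever B n (shift x s)).
Proof.
move=> px; have pxs := plan_shift s px; apply/esym.
apply: (@Ex_supn _ _ _ (fun m => hit_after B n m (shift x s))).
- exact: valid_subdist (px [::] s).
- by move=> m t; exact: hit_after01.
- by move=> m t; exact: hit_after_nd.
Qed.

Lemma hit_ever0 B x s : plan x ->
  hit_ever B 0 x s =
  Ex (x [::] s) (fun t => if `[< B (s, t) >] then 1 else hit_ever B 0 (shift x s) t).
Proof.
move=> px; have pxs := plan_shift s px.
have sx := valid_subdist (px [::] s).
pose g m t := if `[< B (s, t) >] then 1 else hit B m (shift x s) t.
have g01 m t : 0 <= g m t <= 1 by apply: if01 => u; exact: hit01.
have gnd m t : g m t <= g m.+1 t by rewrite /g; case: ifP => // _; exact: hit_nd.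
transitivity (supn (fun m => Ex (x [::] s) (g m))).
  have h01 m := hit_after01 B 0 m s px.
  apply/eqP; rewrite eq_le; apply/andP; split; apply: supn_le => m.
    apply: le_trans (hit_nd B m s px) _.
    by apply: (@supn_ub _ (fun m => Ex (x [::] s) (g m))) => k; exact: Ex_itv.
  exact: (@supn_ub _ (fun m => hit B m x s) m.+1).
rewrite -Ex_supn//; apply: eq_Ex => t _; rewrite /g /hit_ever.
case: ifP => _ //; apply/eqP; rewrite eq_le; apply/andP; split.
  by apply: supn_le.
by apply: (@supn_ub _ (fun=> 1) 0) => _; rewrite ler01 lexx.
Qed.

Lemma hit_ever_ni B n x s : plan x -> hit_ever B n.+1 x s <= hit_ever B n x s.
Proof.
elim: n x s => [|n IHn] x s px; have pxs := plan_shift s px;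
  have sx := valid_subdist (px [::] s).
  rewrite hit_ever0// hit_everS//; apply: Ex_le => //.
  - by apply: bounded_itv => t; exact: hit_ever01.
  - by apply/bounded_itv/if01 => t; exact: hit_ever01.
  by move=> t _; case: ifP => // _; case/andP: (hit_ever01 B 0 t pxs).
rewrite (hit_everS _ n.+1)// (hit_everS _ n)//; apply: Ex_le => //.
- by apply: bounded_itv => t; exact: hit_ever01.
- by apply: bounded_itv => t; exact: hit_ever01.
by move=> t _; exact: IHn.
Qed.

(** [head u h] is the first state of the history h followed by u; from s only histories that begin
    at s are consulted. *)
Lemma hit_ext B m x y s : (forall h u, head u h = s -> x h u = y h u) ->
  hit B m x s = hit B m y s.
Proof.
case: m => //= m xy; rewrite xy//; suff -> : shift x s = shift y s by [].
by apply/funext => h; apply/funext => u; exact: xy.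
Qed.

Lemma hit_after_ext B n m x y s : (forall h u, head u h = s -> x h u = y h u) ->
  hit_after B n m x s = hit_after B n m y s.
Proof.
case: n => [|n] xy; first exact: hit_ext.
rewrite /= xy//; suff -> : shift x s = shift y s by [].
by apply/funext => h; apply/funext => u; exact: xy.
Qed.

(** * The winning probability and its supremum over plans *)

Variable A : nat -> set (M * M).
Hypothesis A_decr : forall i j, (i <= j)%N -> A j `<=` A i.

(* The probability of the objective under the plan x from s: by monotonicity of
   A it is the limit of the probabilities of seeing A_n after time n. *)
Definition win x s := infn (fun n => hit_ever (A n) n x s).

Lemma win01 x s : plan x -> 0 <= win x s <= 1.
Proof. by move=> px; apply: infn_itv => n; exact: hit_ever01. Qed.

Lemma win_le_hit_ever n x s : plan x -> win x s <= hit_ever (A n) n x s.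
Proof.
move=> px; apply: (@infn_lb _ (fun n => hit_ever (A n) n x s)) => k.
exact: hit_ever01.
Qed.

Lemma win_le_reach i x s : plan x -> win x s <= hit_ever (A i) 0 x s.
Proof.
move=> px; apply: le_trans (win_le_hit_ever i s px) _.
by elim: {2}i => [//|n IHn]; apply: le_trans IHn; exact: hit_ever_ni.
Qed.

Lemma winS x s : plan x -> win x s = Ex (x [::] s) (win (shift x s)).
Proof.
move=> px; have pxs := plan_shift s px; have sx := valid_subdist (px [::] s).
(* After the first move the time index drops by one while the index of A stays; as A decreases, this
   shift does not affect the infimum. *)
pose h n t := hit_ever (A n.+1) n (shift x s) t.
have h01 n t : 0 <= h n t <= 1 by exact: hit_ever01.
have hni n t : h n.+1 t <= h n t.
  apply: le_trans (hit_ever_ni _ n t pxs).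
  by apply: hit_ever_sub => //; exact: A_decr.
have eh t : infn (h ^~ t) = win (shift x s) t.
  apply/eqP; rewrite eq_le; apply/andP; split; apply: infn_ge => n.
    apply: le_trans (infn_lb n (h01 ^~ t)) _.
    by apply: hit_ever_sub => //; exact: A_decr.
  apply: le_trans (win_le_hit_ever n.+1 t pxs) _; exact: hit_ever_ni.
transitivity (Ex (x [::] s) (fun t => infn (h ^~ t))); last by apply: eq_Ex.
rewrite Ex_infn//.
have e01 n : 0 <= Ex (x [::] s) (h n) <= 1 by exact: Ex_itv.
apply/eqP; rewrite eq_le; apply/andP; split; apply: infn_ge => n.
  by rewrite -hit_everS//; exact: win_le_hit_ever.
apply: le_trans (infn_lb n e01) _; rewrite -hit_everS//.
by apply: le_trans (hit_ever_ni _ n s px); apply: hit_ever_sub => //; exact: A_decr.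
Qed.

Lemma win_ext x y s : (forall h u, head u h = s -> x h u = y h u) -> win x s = win y s.
Proof.
move=> xy; rewrite /win; congr infn; apply/funext => n.
rewrite /hit_ever; congr supn; apply/funext => m.
exact: hit_after_ext.
Qed.

(** The continuation is selected by the state reached after the first move, which is [head u h']. *)
Definition join (d : M -> M -> R) (y : M -> seq M -> M -> M -> R) (h : seq M) (u : M) :=
  if h is _ :: h' then y (head u h') h' u else d u.

Lemma plan_join (d : M -> M -> R) (y : M -> seq M -> M -> M -> R) :
  (forall s, valid s (d s)) -> (forall s, plan (y s)) ->
  plan (join d y).
Proof. by move=> vd py [|a h] u /=; [exact: vd|exact: py]. Qed.

Lemma win_join (d : M -> M -> R) (y : M -> seq M -> M -> M -> R) s :
  (forall s, valid s (d s)) -> (forall s, plan (y s)) ->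
  win (join d y) s = Ex (d s) (fun t => win (y t) t).
Proof.
move=> vd py; rewrite winS//; last exact: plan_join.
apply: eq_Ex => t _; apply: win_ext => h u hu.
by rewrite /shift /= hu.
Qed.

Definition wins (s : M) : set R := [set p | exists2 x, plan x & p = win x s].

Definition best s := sup (wins s).

Lemma exists_plan : exists x, plan x.
Proof. by have [d vd] := choice valid_default; exists (fun=> d) => h s. Qed.

Lemma has_sup_wins s : has_sup (wins s).
Proof.
split; last by exists 1 => _ [x px ->]; case/andP: (win01 s px).
by have [x px] := exists_plan; exists (win x s), x.
Qed.

Lemma win_le_best x s : plan x -> win x s <= best s.
Proof. by move=> px; apply: (sup_upper_bound (has_sup_wins s)); exists x. Qed.

Lemma best01 s : 0 <= best s <= 1.
Proof.
apply/andP; split.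
  have [x px] := exists_plan; apply: le_trans (win_le_best s px).
  by case/andP: (win01 s px).
apply: ge_sup; first exact: (has_sup_wins s).1.
by move=> _ [x px ->]; case/andP: (win01 s px).
Qed.

(** After the first move d, a plan that is optimal up to e is followed from whichever state is
    reached. *)
Lemma best_excessive s d : valid s d -> Ex d best <= best s.
Proof.
move=> vd; apply/le_eps => e e0.
have /choice[y hy] : forall t, exists x, plan x /\ best t - e <= win x t.
  move=> t; have [_ [x px ->] /ltW h] := sup_adherent e0 (has_sup_wins t).
  by exists x.
have [d0 vd0] := choice valid_default.
pose d' t := if t == s then d else d0 t.
have vd' t : valid t (d' t) by rewrite /d'; case: eqP => [->|].
have py t : plan (y t) by exact: (hy t).1.
apply: le_trans (win_le_best s (plan_join vd' py)).
rewrite win_join// /d' eqxx; have [sd d1 _ _] := vd.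
have bb := bounded_itv best01.
apply: (@le_trans _ _ (Ex d (fun t => best t - e))).
  by rewrite ExB//; [rewrite Ex_cst// d1 mulr1|exact: bounded_fn_cst].
apply: Ex_le => //.
- by apply: bounded_fnB => //; exact: bounded_fn_cst.
- by apply: bounded_itv => t; exact: win01.
by move=> t _; exact: (hy t).2.
Qed.

Definition attained s := exists2 x, plan x & win x s = best s.

(** The deficits [best] - [win] after the first move are nonnegative with mean at most 0, so they
    vanish at every state reached with positive probability. *)
Lemma attained_shift x s t : plan x -> win x s = best s -> 0 < x [::] s t ->
  win (shift x s) t = best t.
Proof.
move=> px opt xt; have pxs := plan_shift s px.
have [sx _ _ _] := px [::] s; have bb := bounded_itv best01.
have bwin : bounded_fn (win (shift x s)) by apply: bounded_itv => u; exact: win01.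
have ge0 u : 0 <= best u - win (shift x s) u by rewrite subr_ge0 win_le_best.
apply/eqP; rewrite eq_le win_le_best//= -subr_le0.
rewrite -(pmulr_rle0 _ xt).
have bbw := bounded_fnB bb bwin.
apply: le_trans (_ : Ex (x [::] s) (fun u => best u - win (shift x s) u) <= 0); last first.
  by rewrite ExB// -winS// opt subr_le0; exact: best_excessive.
apply: (@term_le_tsum _ _ (fun u => x [::] s u * (best u - win (shift x s) u))).
  by move=> u; rewrite mulr_ge0// sx.1.
exact: Ex_cvg.
Qed.

(** * The weight function and the game it defines *)

Definition weight s : R := if `[< attained s >] then best s else 0.

Lemma weight01 s : 0 <= weight s <= 1.
Proof. by rewrite /weight; case: ifP => _; [exact: best01|rewrite lexx ler01]. Qed.

Lemma weight_le_best s : weight s <= best s.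
Proof. by rewrite /weight; case: ifP => // _; case/andP: (best01 s). Qed.

Lemma act_valid s d : act weight s 1 d <-> valid s d /\ weight s <= Ex d weight.
Proof.
split=> [[sd d1 dt dr dw]|[[sd d1 dt dr] dw]].
  by split; [split=> // /dr h t; rewrite h mul1r|rewrite mul1r in dw].
by split => //; [move=> /dr h t; rewrite h mul1r|rewrite mul1r].
Qed.

(** The states reached have optimal plans themselves, so [weight] and [best] agree there. *)
Lemma attained_act x s : plan x -> win x s = best s -> act weight s 1 (x [::] s).
Proof.
move=> px opt; apply/act_valid; split; first exact: px.
apply: le_trans (weight_le_best s) _; rewrite -opt winS//.
have pxs := plan_shift s px; have [sx _ _ _] := px [::] s.
apply: Ex_le => //.
- by apply: bounded_itv => u; exact: win01.
- exact: bounded_itv weight01.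
move=> t xt; have h := attained_shift px opt xt.
by rewrite h /weight asboolT//; exists (shift x s).
Qed.

Lemma act_weight_neq0 s : exists d, act weight s 1 d.
Proof.
have [[x px opt]|na] := pselect (attained s).
  by exists (x [::] s); exact: attained_act.
have [d vd] := valid_default s; exists d; apply/act_valid; split => //.
rewrite {1}/weight asboolF//; have [sd _ _ _] := vd; apply: Ex_ge0 => //.
  exact: bounded_itv weight01.
by move=> t; case/andP: (weight01 t).
Qed.

Lemma act_weight_le s d : act weight s 1 d -> weight s != 0 -> Ex d weight <= weight s.
Proof.
move=> /act_valid[vd _]; rewrite /weight; case: ifPn => [_ _|]; last by rewrite eqxx.
have [sd _ _ _] := vd; apply: le_trans (best_excessive vd).
apply: Ex_le => //; [exact: bounded_itv weight01|exact: bounded_itv best01|].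
by move=> t _; exact: weight_le_best.
Qed.

Let l11 : 0 <= (1 : R) <= 1. Proof. by rewrite ler01 lexx. Qed.

Let acts_subdist s d : acts weight s d -> subdist d. Proof. by case. Qed.

Let v i n := bellman_iter weight 1 (A i) (acts weight) n.

Let v01 i n t : 0 <= v i n t <= 1 :=
  bellman_iter01 weight01 acts_subdist act_weight_neq0 (A i) n t l11.

(* Once an A_i-edge has been seen an optimal plan still has to win with the full
   value, so the win probability is at most the expected value at the first
   A_i-edge within m steps plus the probability of seeing A_i only later. *)
Lemma win_le_bellman i m x s : plan x -> win x s = best s ->
  win x s <= v i m s + hit_ever (A i) 0 x s - hit (A i) m x s.
Proof.
elim: m x s => [|m IHm] x s px opt.
  by rewrite /v /= add0r subr0; exact: win_le_reach.
have pxs := plan_shift s px; have [sx _ _ _] := px [::] s.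
have [ws0|ws0] := eqVneq (weight s) 0.
  have hs : attained s by exists x.
  rewrite opt; rewrite /weight asboolT// in ws0; rewrite ws0.
  have := v01 i m.+1 s; have := hit_after_le_ever (A i) 0 m.+1 s px; rewrite /=; lra.
have a1 := attained_act px opt.
have := bellman_ub weight01 acts_subdist (A i) (v01 i m) a1.
have -> : v i m.+1 s = bellman weight (A i) (acts weight) (v i m) s.
  by rewrite /v /= mul1r.
move=> hb.
suff : win x s <= Ex (x [::] s) (pay weight (A i) (v i m) s) +
   hit_ever (A i) 0 x s - hit (A i) m.+1 x s by move: hb => /=; lra.
rewrite hit_ever0// winS//=.
set f := fun t => if _ then 1 else hit_ever _ _ _ _.
set g := fun t => if _ then 1 else hit _ _ _ _.
have bf : bounded_fn f by apply/bounded_itv/if01 => t; exact: hit_ever01.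
have bg : bounded_fn g by apply/bounded_itv/if01 => t; exact: hit01.
have bp : bounded_fn (pay weight (A i) (v i m) s).
  exact: (bounded_pay weight01 _ _ (v01 i m)).
have bpf := bounded_fnD bp bf.
rewrite -ExD// -ExB//; apply: Ex_le => //.
- by apply: bounded_itv => t; exact: win01.
- exact: bounded_fnB.
move=> t xt; have ot := attained_shift px opt xt.
(* On an A_i-edge [f] and [g] are both 1 and cancel, and the payment is [best], which the
   continuation wins. *)
rewrite /pay (negbTE ws0) /f /g; case: ifPn => [_|_]; last exact: IHm.
rewrite addrK ot /weight asboolT//; by exists (shift x s).
Qed.

(** For a large horizon the correction term in [win_le_bellman] is at most e; without an optimal
    plan the weight is 0. *)
Lemma weight_bellman i s e : 0 < e -> exists n, weight s - e <= v i n s.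
Proof.
move=> e0; have [as_|na] := pselect (attained s); last first.
  by exists 0%N; rewrite /weight asboolF// sub0r oppr_le0 ltW.
have [x px opt] := as_.
have hs : has_sup (range (fun m => hit_after (A i) 0 m x s)).
  split; first by eexists; exists 0%N.
  by exists 1 => _ [m _ <-]; case/andP: (hit_after01 (A i) 0 m s px).
have [_ [m _ <-] /ltW hm] := sup_adherent e0 hs.
exists m; rewrite /weight asboolT// -opt.
have := win_le_bellman i m px opt; rewrite /hit_ever /supn.
move: hm => /=; set S := sup _; lra.
Qed.

(** Payments are at most 1, so the payoff is at most the probability of seeing A_i; since w does not
    decrease on average, the resulting bound is carried past any time n. *)
Lemma stationary_win (sigma : M -> M -> R) s :
  (forall s, act weight s 1 (sigma s)) ->
  (forall i s e, 0 < e -> exists n, weight s - e <= reach_pay weight (A i) sigma n s) ->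
  weight s <= win (fun=> sigma) s.
Proof.
move=> asig hr; pose x (_ : seq M) := sigma.
have px : plan x by move=> h t; have [] := (act_valid t (sigma t)).1 (asig t).
have ssig t : subdist (sigma t) by case: (asig t).
have le1 i n t : reach_pay weight (A i) sigma n t <= hit (A i) n x t.
  elim: n t => //= n IHn t; apply: Ex_le => //.
  - exact: (bounded_pay weight01 _ _ (reach_pay01 weight01 (A i) n ssig)).
  - by apply/bounded_itv/if01 => u; exact: hit01.
  move=> u _; rewrite /pay; case: ifP => _.
    by case/andP: (if01 (A i) t (fun u => hit01 (A i) n u px) u).
  by case: ifP => _ //; case/andP: (weight01 u).
have le2 i n t : weight t <= hit_ever (A i) n x t.
  elim: n t => [|n IHn] t.
    apply/le_eps => e e0; have [n hn] := hr i t e e0.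
    apply: le_trans hn _; apply: le_trans (le1 i n t) _.
    exact: (hit_after_le_ever (A i) 0 n t px).
  rewrite hit_everS//; have [_ ] := (act_valid t (sigma t)).1 (asig t).
  move=> /le_trans; apply; apply: Ex_le => //.
  - exact: bounded_itv weight01.
  - by apply: bounded_itv => u; exact: hit_ever01.
by apply: infn_ge.
Qed.

Theorem stationary_optimal : exists sigma : M -> M -> R,
  plan (fun=> sigma) /\
  forall s, attained s -> win (fun=> sigma) s = best s.
Proof.
have [sigma [asig hr]] := stationary_reach_all weight01 act_weight_neq0
  act_weight_le weight_bellman.
have px : plan (fun=> sigma).
  by move=> h t; have [] := (act_valid t (sigma t)).1 (asig t).
exists sigma; split => // s as_; apply/eqP; rewrite eq_le win_le_best//=.
by have := stationary_win s asig hr; rewrite /weight asboolT.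
Qed.

End Plans.

(** * Laws of runs *)

Section LawUnique.
Variables (R : realType) (M : mdp R) (x : seq M -> M -> M -> R) (s0 : M).
Hypothesis px : plan x.

Definition path_prob (f : nat -> M) n : R :=
  \prod_(i < n) x (mkseq f i) (f i) (f i.+1).

Definition plan_law (mu : probability (run_space s0) R) : Prop :=
  forall (rho : run s0) n, mu (cylinder rho n) = (path_prob rho n)%:E.

Lemma mkseq_agree (f g : nat -> M) n i : (forall i, (i <= n)%N -> f i = g i) ->
  (i <= n.+1)%N -> mkseq f i = mkseq g i.
Proof.
move=> fg ijn; apply/eq_in_map => j; rewrite mem_iota add0n => /andP[_ ji].
by apply: fg; rewrite -ltnS (leq_trans ji).
Qed.

Lemma path_prob_agree (f g : nat -> M) n : (forall i, (i <= n)%N -> f i = g i) ->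
  path_prob f n = path_prob g n.
Proof.
move=> fg; apply: eq_bigr => i _; rewrite (mkseq_agree fg) ?fg//.
- by rewrite ltnW.
- by rewrite ltnW// ltnS ltnW.
Qed.

Lemma path_probS (f : nat -> M) n :
  path_prob f n.+1 = path_prob f n * x (mkseq f n) (f n) (f n.+1).
Proof. by rewrite /path_prob big_ord_recr. Qed.

Lemma path_prob_ge0 (f : nat -> M) n : 0 <= path_prob f n.
Proof. by apply: prodr_ge0 => i _; have [[]] := px (mkseq f i) (f i). Qed.

Lemma measurable_cylinder (rho : run s0) n :
  measurable (cylinder rho n : set (run_space s0)).
Proof. by apply: sub_sigma_algebra; exists rho, n. Qed.

(** Cylinders are given by infinite runs, so a prefix extended by t has to be continued; the default
    run from t does this. *)
Lemma splice_run (rho : run s0) n t : trans (rho n) t ->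
  exists rho' : run s0, (forall i, (i <= n)%N -> rho' i = rho i) /\ rho' n.+1 = t.
Proof.
move=> rt; pose f i := if (i <= n)%N then rho i else default_run t (i - n.+1)%N.
have f0 : f 0%N = s0 by rewrite /f run_init.
have ft i : trans (f i) (f i.+1).
  rewrite /f; case: (ltngtP i n) => h.
  - exact: run_trans.
  - by rewrite (subSn h); exact: run_trans.
  - by rewrite h subnn.
exists (Run f0 ft); split=> [i ni|]; rewrite /= /f ?ni//.
by rewrite ltnn subnn.
Qed.

(** There are countably many prefixes, and each contributes a cylinder or the empty set. *)
Lemma measurable_prefix (S : set (run_space s0)) n :
  (forall r r' : run s0, (forall i, (i <= n)%N -> r i = r' i) -> S r -> S r') ->
  measurable S.
Proof.
move=> Sn.
have -> : S = \bigcup_(w : seq M) (S `&` [set r : run s0 | mkseq r n.+1 = w]).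
  by apply/seteqP; split=> [r Sr|r [w _ []//]]; exists (mkseq r n.+1).
apply: countable_bigcupT_measurable; first exact: countableP.
move=> w; have [[r [Sr rw]]|nr] := pselect (exists r : run s0, S r /\ mkseq r n.+1 = w).
  suff -> : S `&` [set r : run s0 | mkseq r n.+1 = w] = cylinder r n.
    exact: measurable_cylinder.
  apply/seteqP; split=> [r' [_ /=]|r' hr'].
    rewrite -rw => e i ni; have := congr1 (fun q => nth (r i) q i) e.
    by rewrite !nth_mkseq.
  split; first by apply: Sn Sr => i ni; rewrite hr'.
  by rewrite /= -rw; exact: mkseq_agree hr' _.
rewrite (_ : _ `&` _ = set0)//; apply/seteqP; split=> // r [Sr rw].
by apply: nr; exists r.
Qed.

Variable mu : probability (run_space s0) R.
Hypothesis mu_law : plan_law mu.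

(** The cylinder splits by the next state into disjoint pieces, and countable additivity turns the
    sum of their measures into an expectation. *)
Lemma cylinder_step (rho : run s0) k (B : set (run_space s0)) (g : M -> R) :
  measurable B -> (forall t, 0 <= g t <= 1) ->
  (forall rho' : run s0, (forall i, (i <= k)%N -> rho' i = rho i) ->
     mu (cylinder rho' k.+1 `&` B) = (path_prob rho' k.+1 * g (rho' k.+1))%:E) ->
  mu (cylinder rho k `&` B) =
    (path_prob rho k * Ex (x (mkseq rho k) (rho k)) g)%:E.
Proof.
move=> mB g01 hstep; pose d := x (mkseq rho k) (rho k).
have [sd d1 dt _] : valid (rho k) d := px _ _.
pose next t := cylinder rho k `&` [set r : run s0 | r k.+1 = t].
have next_trans t : trans (rho k) t -> exists rho' : run s0,
    [/\ forall i, (i <= k)%N -> rho' i = rho i, rho' k.+1 = t & next t = cylinder rho' k.+1].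
  move=> /splice_run[rho' [h1 h2]]; exists rho'; split => //.
  apply/seteqP; split=> r /=.
    move=> [hr rt] i; rewrite leq_eqVlt => /orP[/eqP->|ik]; first by rewrite h2.
    by rewrite hr// h1.
  by move=> hr; split=> [i ik|/=]; [rewrite hr ?h1// ltnW|rewrite hr].
have next_ntrans t : ~~ trans (rho k) t -> next t = set0.
  move=> nt; apply/seteqP; split=> // r [hr /= rt].
  by move: nt; rewrite -rt -hr// run_trans.
pose F j : set (run_space s0) :=
  if @pickle_inv M j is Some t then next t `&` B else set0.
have mnext t : measurable (next t : set (run_space s0)).
  case: (boolP (trans (rho k) t)) => [/next_trans[r [_ _ ->]]|/next_ntrans ->//].
  exact: measurable_cylinder.
have mF j : measurable (F j).
  by rewrite /F; case: pickle_inv => // t; exact: measurableI.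
have UF : cylinder rho k `&` B = \bigcup_j F j.
  apply/seteqP; split=> [r [hr Br]|r [j _]].
    by exists (pickle (r k.+1)) => //; rewrite /F pickleK_inv.
  by rewrite /F; case: pickle_inv => // t [[]].
have tF : trivIset setT F.
  apply/trivIsetP => i j _ _ ij; apply/seteqP; split=> // r [].
  rewrite /F; case ei : pickle_inv => [t|] //; case ej : pickle_inv => [t'|] //.
  move=> [[_ /= rt] _] [[_ /= rt'] _]; move: ij.
  have := @pickle_invK M i; rewrite ei /= => <-.
  by have := @pickle_invK M j; rewrite ej /= => <-; rewrite -rt -rt' eqxx.
rewrite UF measure_semi_bigcup//; last exact: bigcup_measurable.
pose f t := d t * (path_prob rho k * g t).
have p0 := path_prob_ge0 rho k.
have bg := bounded_itv g01.
have f0 t : 0 <= f t.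
  by rewrite /f !mulr_ge0//; [exact: sd.1|case/andP: (g01 t)].
have cf : cvgn (series (at_code f)) by apply: Ex_cvg => //; exact: bounded_fnZ.
transitivity (\sum_(j <oo) (at_code f j)%:E)%E; last first.
  by rewrite nneseries_tsum// -/(Ex _ _) ExZ.
apply: eq_eseriesr => j _; rewrite /F /at_code; case: pickle_inv => [t|] /=; last first.
  exact: measure0.
case: (boolP (trans (rho k) t)) => [|nt]; last first.
  by rewrite next_ntrans// set0I measure0 /f dt// mul0r.
move=> /next_trans[rho' [h1 h2 ->]]; rewrite hstep// path_probS h2 /f.
rewrite (path_prob_agree h1) (mkseq_agree h1)// h1//; congr (_%:E).
by rewrite /d; ring.
Qed.

Definition sees (B : set (M * M)) (j m : nat) : set (run_space s0) :=
  [set r : run s0 | exists i, (j <= i < j + m)%N /\ B (run_edge r i)].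

Lemma measurable_sees B j m : measurable (sees B j m).
Proof.
apply: (@measurable_prefix _ (j + m)) => r r' rr' [i [/andP[ji ijm] Bi]].
exists i; split; first by rewrite ji.
by rewrite /run_edge -!rr'// ltnW.
Qed.

Let tail (rho : run s0) k h := x (mkseq rho k ++ h).

Let plan_tail rho k : plan (tail rho k). Proof. by move=> h s; exact: px. Qed.

Let shift_tail (rho rho' : run s0) k : (forall i, (i <= k)%N -> rho' i = rho i) ->
  shift (tail rho k) (rho k) = tail rho' k.+1.
Proof.
move=> h; apply/funext => q; rewrite /shift /tail (mkseq_agree h)//.
by rewrite mkseqS cat_rcons.
Qed.

(** If the first edge lies in B, the whole longer cylinder is in the event; otherwise the window
    moves on by one. *)
Lemma law_sees0 B m k (rho : run s0) :
  mu (cylinder rho k `&` sees B k m) =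
    (path_prob rho k * hit B m (tail rho k) (rho k))%:E.
Proof.
elim: m k rho => [|m IHm] k rho.
  rewrite (_ : sees B k 0 = set0) ?setI0 ?measure0 ?mulr0//.
  by apply/seteqP; split=> // r [i [/andP[]]]; rewrite addn0 leqNgt => /negP.
have -> : hit B m.+1 (tail rho k) (rho k) = Ex (x (mkseq rho k) (rho k))
   (fun t => if `[< B (rho k, t) >] then 1 else hit B m (shift (tail rho k) (rho k)) t).
  by rewrite /= /tail cats0.
apply: cylinder_step; first exact: measurable_sees.
  move=> t; case: ifP => _; first by rewrite ler01 lexx.
  by apply: hit01; apply: plan_shift; exact: plan_tail.
move=> rho' h; rewrite (shift_tail h); case: ifPn => [/asboolP b|/asboolPn nb].
  rewrite mulr1 -mu_law; congr (mu _); apply/seteqP; split=> [r []//|r hr].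
  split => //; exists k; split; first by rewrite leqnn/= addnS ltnS leq_addr.
  by rewrite /run_edge !hr// h.
rewrite -IHm; congr (mu _); apply/seteqP; split=> r [hr [i [/andP[i1 i2] Bi]]].
  split => //; exists i; split => //; rewrite addSnnS i2 andbT.
  rewrite ltn_neqAle i1 andbT; apply/eqP => ik; apply: nb.
  by move: Bi; rewrite -ik /run_edge !hr// h.
by split => //; exists i; split => //; rewrite -addSnnS i2 andbT ltnW.
Qed.

Lemma law_sees B n m k (rho : run s0) :
  mu (cylinder rho k `&` sees B (k + n) m) =
    (path_prob rho k * hit_after B n m (tail rho k) (rho k))%:E.
Proof.
elim: n k rho => [|n IHn] k rho; first by rewrite addn0 law_sees0.
have -> : hit_after B n.+1 m (tail rho k) (rho k) = Ex (x (mkseq rho k) (rho k))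
   (hit_after B n m (shift (tail rho k) (rho k))).
  by rewrite /= /tail cats0.
apply: cylinder_step; first exact: measurable_sees.
  by move=> t; apply: hit_after01; apply: plan_shift; exact: plan_tail.
by move=> rho' h; rewrite (shift_tail h) -IHn addSnnS.
Qed.

Lemma law_hit_after B n m : mu (sees B n m) = (hit_after B n m x s0)%:E.
Proof.
have := law_sees B n m 0 (default_run s0); rewrite add0n.
have -> : cylinder (default_run s0) 0 = setT.
  by apply/seteqP; split=> // r _ i; rewrite leqn0 => /eqP ->; rewrite !run_init.
by rewrite setTI => ->; rewrite /path_prob big_ord0 mul1r run_init.
Qed.

Variable A : nat -> set (M * M).
Hypothesis A_decr : forall i j, (i <= j)%N -> A j `<=` A i.

(** Seeing [A n] after time n for every n is enough: given i and n, this is used at the maximum of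
    both. *)
Lemma objectiveE :
  \bigcap_i GF (A i) s0 = \bigcap_n \bigcup_m (sees (A n) n m).
Proof.
apply/seteqP; split=> r h.
  move=> n _; have [i [ni Ai]] := h n I n.
  by exists i.+1 => //; exists i; split => //; rewrite ni/= addnS ltnS leq_addl.
move=> i _ n; have [m _ [j [/andP[j1 _] Aj]]] := h (maxn i n) I.
exists j; split; first by rewrite (leq_trans _ j1)// leq_maxr.
by apply: A_decr Aj; exact: leq_maxl.
Qed.

Lemma law_hit_ever B n : mu (\bigcup_m sees B n m) = (hit_ever B n x s0)%:E.
Proof.
have ms m := measurable_sees B n m.
have nd : nondecreasing_seq (sees B n).
  move=> i j ij; apply/subsetPset => r [q [/andP[q1 q2] Bq]].
  by exists q; split => //; rewrite q1 (leq_trans q2)// leq_add2l.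
have c1 := nondecreasing_cvg_mu (mu := mu) ms (bigcup_measurable (fun m _ => ms m)) nd.
have c2 : mu \o sees B n @ \oo --> (hit_ever B n x s0)%:E.
  rewrite (_ : mu \o _ = EFin \o (fun m => hit_after B n m x s0)); last first.
    by apply/funext => m /=; exact: law_hit_after.
  apply: cvg_EFin; first exact: nearW.
  by apply: supn_cvg => m; [exact: hit_after01|exact: hit_after_nd].
by rewrite -(cvg_lim _ c1)// -(cvg_lim _ c2).
Qed.

(** Continuity from above along n, after continuity from below along the window length in
    [law_hit_ever]. *)
Lemma law_win : mu (\bigcap_i GF (A i) s0) = (win A x s0)%:E.
Proof.
rewrite objectiveE; pose F n := \bigcup_m sees (A n) n m.
have mF n : measurable (F n) by apply: bigcup_measurable => m _; exact: measurable_sees.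
have ni : nonincreasing_seq F.
  apply/nonincreasing_seqP => n; apply/subsetPset => r [m _ [i [/andP[i1 i2] Ai]]].
  exists m.+1 => //; exists i; split; last exact: A_decr Ai.
  by rewrite ltnW//= addnS -addSn.
have F0 : (mu (F 0%N) < +oo)%E by rewrite ltey_eq fin_num_measure.
have c1 := nonincreasing_cvg_mu (mu := mu) F0 mF (bigcap_measurableType (fun n _ => mF n)) ni.
have c2 : mu \o F @ \oo --> (win A x s0)%:E.
  rewrite (_ : mu \o _ = EFin \o (fun n => hit_ever (A n) n x s0)); last first.
    by apply/funext => n /=; exact: law_hit_ever.
  apply: cvg_EFin; first exact: nearW.
  apply: infn_cvg => n; first exact: hit_ever01.
  by apply: le_trans (hit_ever_ni _ n s0 px); apply: hit_ever_sub => //; exact: A_decr.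
by rewrite -(cvg_lim _ c1)// -(cvg_lim _ c2).
Qed.

End LawUnique.

(** * The uniform distribution on [0, 1) *)

Section UnitMeasure.
Variable R : realType.

Definition unit_interval : set (measurableTypeR R) := [set` `[0 : R, 1[ ].

Lemma measurable_unit_interval : measurable unit_interval.
Proof. exact: measurable_itv. Qed.

Definition unit_measure : set (measurableTypeR R) -> \bar R :=
  mrestr lebesgue_measure measurable_unit_interval.

HB.instance Definition _ := Measure.on unit_measure.

Lemma unit_measureT : unit_measure setT = 1%E.
Proof.
rewrite /unit_measure /mrestr setTI /unit_interval lebesgue_measure_itv /=.
by rewrite lte_fin ltr01 -EFinB subr0.
Qed.

HB.instance Definition _ :=
  Measure_isProbability.Build _ _ _ unit_measure unit_measureT.

End UnitMeasure.

(** * Existence of the law of runs *)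

Section LawExists.
Variables (R : realType) (M : mdp R) (x : seq M -> M -> M -> R) (s0 : M).
Hypothesis px : plan x.

(* Left end of the subinterval of [0, 1) attached to f(0), ..., f(n); its length
   is path_prob, and the intervals of the one-step extensions partition it. *)
Fixpoint left_end (f : nat -> M) n : R :=
  if n is n'.+1 then
    left_end f n' + path_prob x f n' * psum (x (mkseq f n') (f n')) (pickle (f n))
  else 0.

Definition slot (f : nat -> M) n : set R :=
  [set` `[left_end f n, left_end f n + path_prob x f n[ ].

Lemma slotE f n u :
  slot f n u = (left_end f n <= u < left_end f n + path_prob x f n) :> Prop.
Proof. by rewrite /slot /= in_itv. Qed.

Lemma left_end_agree (f g : nat -> M) n : (forall i, (i <= n)%N -> f i = g i) ->
  left_end f n = left_end g n.
Proof.
elim: n => //= n IHn fg.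
have fg' i : (i <= n)%N -> f i = g i by move=> h; rewrite fg// ltnW.
by rewrite IHn// (path_prob_agree x fg') (mkseq_agree fg')// (fg n)// (fg n.+1).
Qed.

Lemma slot_agree (f g : nat -> M) n : (forall i, (i <= n)%N -> f i = g i) ->
  slot f n = slot g n.
Proof. by move=> fg; rewrite /slot (left_end_agree fg) (path_prob_agree x fg). Qed.

Lemma right_endS f n : left_end f n.+1 + path_prob x f n.+1 =
  left_end f n + path_prob x f n * psum (x (mkseq f n) (f n)) (pickle (f n.+1)).+1.
Proof.
rewrite path_probS /= /psum big_nat_recr//= at_code_pickle; ring.
Qed.

Lemma slotS f n : slot f n.+1 `<=` slot f n.
Proof.
move=> u; rewrite !slotE right_endS /= => /andP[h1 h2].
have p0 := path_prob_ge0 px f n; have [[d0 d1] _ _ _] := px (mkseq f n) (f n).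
apply/andP; split.
  by apply: le_trans h1; rewrite lerDl mulr_ge0// psum_ge0.
by apply: lt_le_trans h2 _; rewrite lerD2l ler_piMr.
Qed.

Lemma slot_le f n m : (n <= m)%N -> slot f m `<=` slot f n.
Proof.
move=> /subnKC <-; elim: (m - n)%N => [|k IHk]; first by rewrite addn0.
by rewrite addnS; apply: subset_trans IHk; exact: slotS.
Qed.

(** Sibling intervals are half-open and ordered by code: the one with the smaller code ends no later
    than the other begins. *)
Lemma slot_inj (f g : nat -> M) n u : (forall i, (i <= n)%N -> f i = g i) ->
  slot f n.+1 u -> slot g n.+1 u -> f n.+1 = g n.+1.
Proof.
wlog : f g / (pickle (f n.+1) <= pickle (g n.+1))%N => [hw fg uf ug|].
  case/orP: (leq_total (pickle (f n.+1)) (pickle (g n.+1))) => h; first exact: hw.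
  by apply/esym; apply: hw => // i ni; rewrite fg.
rewrite leq_eqVlt => /orP[/eqP/(pcan_inj (@pickleK_inv M))//|lt_fg] fg.
rewrite !slotE right_endS => /andP[_ uf] /andP[ug _].
suff : u < u by rewrite ltxx.
apply: lt_le_trans uf _; apply: le_trans ug => /=.
rewrite (left_end_agree fg) (path_prob_agree x fg) (mkseq_agree fg)// (fg n)//.
rewrite lerD2l ler_wpM2l ?path_prob_ge0//.
by have [[d0 _] _ _ _] := px (mkseq g n) (g n); exact: psum_nd.
Qed.

(** With y the relative position of u in the interval, t is the first state, in the order of codes,
    at which the cumulated mass exceeds y; its mass is positive, so it is a successor. *)
Lemma inverse_cdf s (d : M -> R) a p u : valid s d -> a <= u < a + p ->
  exists t, trans s t /\
    a + p * psum d (pickle t) <= u < a + p * psum d (pickle t) + p * d t.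
Proof.
move=> [sd d1 dt _] /andP[au ua].
have p0 : 0 < p by lra.
pose y := (u - a) / p.
have y0 : 0 <= y by rewrite divr_ge0 ?subr_ge0// ltW.
have y1 : y < 1 by rewrite ltr_pdivrMr// mul1r; lra.
have [k hk] : exists k, y < psum d k.
  apply/not_existsP => h; suff : 1 <= y by rewrite leNgt y1.
  rewrite -d1; apply: tsum_le; first exact: subdist_cvg.
  by move=> n; rewrite leNgt; apply/negP/h.
have ex : exists k, y < psum d k by exists k.
case: (ex_minnP ex) => -[|m] hm hmin.
  by move: hm; rewrite /psum big_nil ltNge y0.
have ym : psum d m <= y.
  by rewrite leNgt; apply/negP => /hmin; rewrite ltnn.
have hm' : psum d m.+1 = psum d m + at_code d m by rewrite /psum big_nat_recr.
have : 0 < at_code d m by rewrite hm' in hm; lra.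
rewrite /at_code; case e : pickle_inv => [t|] /=; last by rewrite ltxx.
have em := @pickle_invK M m; rewrite e /= in em.
move=> dpos; exists t; split.
  by apply: contraLR dpos => /dt ->; rewrite ltxx.
have uE : u = a + p * y by rewrite /y mulrCA divff ?gt_eqF// mulr1; lra.
rewrite em uE -addrA -mulrDr lerD2l ltrD2l ler_pM2l// ltr_pM2l// ym /=.
by move: hm; rewrite hm' /at_code e.
Qed.

Lemma exists_coded_run u : 0 <= u < 1 -> exists r : run s0, forall n, slot r n u.
Proof.
move=> u01.
(* Outside the interval an arbitrary successor is taken, so that [nxt] can be iterated without side
   conditions. *)
have /choice[nxt hnxt] : forall q : (seq M * M) * (R * R), exists t,
    trans q.1.2 t /\ (q.2.1 <= u < q.2.1 + q.2.2 ->
    q.2.1 + q.2.2 * psum (x q.1.1 q.1.2) (pickle t) <= u <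
    q.2.1 + q.2.2 * psum (x q.1.1 q.1.2) (pickle t) + q.2.2 * x q.1.1 q.1.2 t).
  move=> [[h s] [a p]] /=; case: (boolP (a <= u < a + p)) => hu.
    by have [t [st ht]] := inverse_cdf (px h s) hu; exists t.
  by have [t st] := trans_total s; exists t.
pose up (q : (seq M * M) * (R * R)) := let t := nxt q in
  ((rcons q.1.1 q.1.2, t), (q.2.1 + q.2.2 * psum (x q.1.1 q.1.2) (pickle t),
    q.2.2 * x q.1.1 q.1.2 t)).
pose st n := iter n up (([::], s0), (0, 1)).
pose f n := (st n).1.2.
have stE n : st n = ((mkseq f n, f n), (left_end f n, path_prob x f n)).
  elim: n => [|n IHn]; first by rewrite /path_prob big_ord0.
  rewrite /st iterS -/(st n) {1}/up mkseqS path_probS /=.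
  have -> : f n.+1 = nxt (st n) by [].
  by rewrite IHn.
have ft i : trans (f i) (f i.+1) by have [] := hnxt (st i).
exists (Run (erefl : f 0%N = s0) ft) => n; rewrite slotE /=.
elim: n => [|n IHn]; first by rewrite /path_prob big_ord0 /= add0r.
have [_] := hnxt (st n); rewrite stE /= => /(_ IHn).
have -> : nxt (mkseq f n, f n, (left_end f n, path_prob x f n)) = f n.+1.
  by rewrite -stE.
by rewrite path_probS.
Qed.

(** The law is the image of the uniform distribution under a map X that sends u to a run whose slots
    all contain u; within [0, 1) the preimage of a cylinder is its slot. *)
Lemma exists_law : exists mu : probability (run_space s0) R, plan_law x mu.
Proof.
have /choice[X hX] : forall u : R, exists r : run s0,
    if 0 <= u < 1 then forall n, slot r n u else r = default_run s0.
  by move=> u; case: (boolP (0 <= u < 1)) => [u01|_]; [exact: exists_coded_run|exists (default_run s0)].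
have pre (rho : run s0) n (u : R) : 0 <= u < 1 -> cylinder rho n (X u) <-> slot rho n u.
  move=> u01; have := hX u; rewrite u01 => hu; split=> [c|].
    by rewrite -(slot_agree (f := X u)).
  elim: n => [_ i|n IHn hs i].
    by rewrite leqn0 => /eqP ->; rewrite !run_init.
  have c : cylinder rho n (X u) by apply: IHn; exact: slotS.
  rewrite leq_eqVlt => /orP[/eqP ->|]; last by rewrite ltnS; exact: c.
  exact: (slot_inj c (hu n.+1)).
have slot01 rho n u : slot rho n u -> 0 <= u < 1.
  by move=> /(slot_le (leq0n n)); rewrite slotE /= /path_prob big_ord0 add0r.
pose I01 := @unit_interval R.
have I01E u : I01 u = (0 <= u < 1) :> Prop by rewrite /I01 /unit_interval /= in_itv.
have mI01 : measurable I01 := @measurable_unit_interval R.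
have mslot rho n : measurable (slot rho n : set (measurableTypeR R)).
  exact: measurable_itv.
have preE rho n : X @^-1` (cylinder rho n) `&` I01 = slot rho n.
  apply/seteqP; split=> u; first by move=> [c]; rewrite I01E => /pre <-.
  move=> hs; have u01 := slot01 _ _ _ hs; split; last by rewrite I01E.
  exact/pre.
have mX : measurable_fun [set: measurableTypeR R] (X : _ -> run_space s0).
  apply: (@measurability _ _ (measurableTypeR R) (run_space s0) setT X (@cylinders R M s0)) => //.
  move=> _ [_ [rho [n ->]] <-]; rewrite setTI.
  (* Numbers outside [0, 1) go to the default run, so the preimage of a cylinder containing it
     acquires the complement of [0, 1), a null set. *)
  have [c|c] := pselect (cylinder rho n (default_run s0)).
    rewrite (_ : _ @^-1` _ = slot rho n `|` ~` I01).
      by apply: measurableU; [exact: mslot|exact: measurableC].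
    apply/seteqP; split=> u.
      move=> cu; have [hu|hu] := pselect (I01 u); [left|by right].
      by rewrite -preE.
    case; first by rewrite -preE => -[].
    rewrite /= I01E => nu; have := hX u; case: ifP => [//|_] /= ->; exact: c.
  rewrite (_ : _ @^-1` _ = slot rho n); first exact: mslot.
  rewrite -preE; apply/seteqP; split=> u; last by case.
  move=> cu; split => //; rewrite I01E; have := hX u; case: ifP => //= _ e.
  by exfalso; apply: c; rewrite -e.
pose Xm : {mfun measurableTypeR R >-> run_space s0} :=
  HB.pack X (isMeasurableFun.Build _ _ (measurableTypeR R) (run_space s0) X mX).
exists (distribution (@unit_measure R) Xm) => rho n.
rewrite /distribution /pushforward /= /unit_measure /mrestr preE /slot.
rewrite lebesgue_measure_itv /= lte_fin.
have p0 := path_prob_ge0 px rho n.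
case: ifP => [_|]; first by rewrite -EFinB addrC addKr.
by rewrite ltrDl lt_def p0 andbT => /negbFE /eqP ->.
Qed.

End LawExists.

(** * Translation between strategies and plans *)

Section Strategies.
Variables (R : realType) (M : mdp R).

Lemma strategy_plan (sigma : strategy M) : exists2 x, plan x &
  forall s (mu : probability (run_space s) R), run_law sigma mu -> plan_law x mu.
Proof.
have [d vd] := choice (@valid_default R M).
(* Elsewhere a default move keeps the plan valid; the law evaluates it only at random states and
   along histories. *)
pose x h s := if `[< ~~ controlled s \/ is_history h s >]
  then step_prob sigma h s else d s.
exists x => [h s|s mu law rho n].
  rewrite /x; case: ifPn => [/asboolP|_]; last exact: vd.
  case: (boolP (controlled s)) => cs.
    case=> // hh; have /distribution_subdist[sd d1 dt] := choice_distr sigma hh.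
    rewrite (_ : (step_prob sigma h s) = sigma h s).
      by split => // [t /negP|]; [exact: dt|rewrite cs].
    by apply/funext => t; rewrite /step_prob cs.
  move=> _; have /distribution_subdist[sd d1 dt] := prob_distr cs.
  rewrite (_ : (step_prob sigma h s) = prob s).
    by split => // t /negP; exact: dt.
  by apply/funext => t; rewrite /step_prob (negbTE cs).
rewrite law; congr (_%:E); apply: eq_bigr => i _; rewrite /x asboolT//.
case: (boolP (controlled (rho i))) => ci; [right|by left].
by split => //; exists s, rho, i.
Qed.

(** Closed transparently, so that the choices compute to those of x. *)
Definition plan_strategy (x : seq M -> M -> M -> R) (px : plan x) : strategy M.
Proof.
exists x => h s _; apply/distribution_subdist.
by have [sd d1 dt _] := px h s; split => // t /negP; exact: dt.
Defined.

Lemma plan_strategy_law x (px : plan x) s (mu : probability (run_space s) R) :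
  plan_law x mu -> run_law (plan_strategy px) mu.
Proof.
move=> law rho n; rewrite law; congr (_%:E); apply: eq_bigr => i _.
rewrite /step_prob /=; case: ifPn => // ci.
by have [_ _ _ ->] := px (mkseq rho i) (rho i).
Qed.

Variable A : nat -> set (M * M).
Hypothesis A_decr : forall i j, (i <= j)%N -> A j `<=` A i.

(** Both suprema range over the same numbers: strategies extend to plans with the same laws, plans
    give strategies, and every plan has a law. *)
Lemma valueE s : value (\bigcap_i GF (A i) s) = (best A s)%:E.
Proof.
rewrite /best -ereal_sup_EFin; [|exact: (has_sup_wins A s).2|exact: (has_sup_wins A s).1].
congr ereal_sup; apply/seteqP; split=> p.
  move=> [sigma [mu [law ->]]]; have [x px /(_ s mu law) xlaw] := strategy_plan sigma.
  by exists (win A x s); [exists x|rewrite (law_win px xlaw A_decr)].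
move=> [_ [x px ->] <-]; have [mu xlaw] := exists_law s px.
exists (plan_strategy px), mu; split; first exact: plan_strategy_law.
by rewrite (law_win px xlaw A_decr).
Qed.

Lemma optimal_attained s (tau : strategy M) :
  optimal (\bigcap_i GF (A i) s) tau -> attained A s.
Proof.
move=> [mu [law]]; rewrite valueE.
have [x px /(_ s mu law) xlaw] := strategy_plan tau.
by rewrite (law_win px xlaw A_decr) => -[e]; exists x.
Qed.

Lemma plan_strategy_optimal s x (px : plan x) : win A x s = best A s ->
  optimal (\bigcap_i GF (A i) s) (plan_strategy px).
Proof.
move=> e; have [mu xlaw] := exists_law s px.
exists mu; split; first exact: plan_strategy_law.
by rewrite (law_win px xlaw A_decr) e valueE.
Qed.

End Strategies.

Theorem corollary15 (R : realType) (M : mdp R) (A : nat -> set (M * M))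
    (A_trans : forall i, A i `<=` transitions M)
    (A_decr : forall i j, (i <= j)%N -> A j `<=` A i) :
  exists sigma : strategy M,
    positional sigma /\
    forall s : M,
      (exists tau : strategy M, optimal (\bigcap_i GF (A i) s) tau) ->
      optimal (\bigcap_i GF (A i) s) sigma.
Proof.
have [sigma [px opt]] := stationary_optimal A_decr.
(* Positionality holds by computation, as the plan ignores its history. *)
exists (plan_strategy px); split=> [//|s [tau /(optimal_attained A_decr) att]].
exact: plan_strategy_optimal (opt s att).
Qed.
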